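(* Let $d\ge 2$, $1\le m<d$, $\delta\in(0,1)$, and let $f(\boldsymbol{x})=\mathbf{W}^\top\boldsymbol{x}+\boldsymbol{b}$ be an $L$-class affine classifier on $\mathbb{R}^d$, with $\mathbf{W}=[\boldsymbol{w}_1\,\cdots\,\boldsymbol{w}_L]\in\mathbb{R}^{d\times L}$ and $\boldsymbol{b}\in\mathbb{R}^L$. Fix $\boldsymbol{x}_0\in\mathbb{R}^d$ with $f_{\hat k}(\boldsymbol{x}_0)>f_k(\boldsymbol{x}_0)$ for all $k\neq\hat k$, and assume $\boldsymbol{w}_k\neq\boldsymbol{w}_{\hat k}$ for all $k\neq\hat k$. Let $\mathcal{S}$ be a random $m$-dimensional subspace of $\mathbb{R}^d$. Then, with probability at least $1-2(L+1)\delta$, $$\sqrt{\zeta_1(m,\delta)}\sqrt{\tfrac{d}{m}}\,\|\boldsymbol{r}^*\|_2\;\le\;\|\boldsymbol{r}^*_{\mathcal S}\|_2\;\le\;\sqrt{\zeta_2(m,\delta)}\sqrt{\tfrac{d}{m}}\,\|\boldsymbol{r}^*\|_2 .$$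
   Context: For an $L$-class classifier $f=(f_1,\dots,f_L):\mathbb{R}^d\to\mathbb{R}^L$ and a point $\boldsymbol{x}_0$ with estimated label $\hat k=\arg\max_k f_k(\boldsymbol{x}_0)$, and for a linear subspace $\mathcal{S}\subseteq\mathbb{R}^d$ and $k\neq\hat k$, define $\|\boldsymbol{r}^k_{\mathcal S}\|_2=\inf\{\|\boldsymbol{r}\|_2:\boldsymbol{r}\in\mathcal{S},\ f_k(\boldsymbol{x}_0+\boldsymbol{r})\ge f_{\hat k}(\boldsymbol{x}_0+\boldsymbol{r})\}$ (with $\inf\emptyset=+\infty$), $\|\boldsymbol{r}^k\|_2:=\|\boldsymbol{r}^k_{\mathbb{R}^d}\|_2$, $\|\boldsymbol{r}^*_{\mathcal S}\|_2=\min_{k\neq\hat k}\|\boldsymbol{r}^k_{\mathcal S}\|_2$ and $\|\boldsymbol{r}^*\|_2=\min_{k\neq\hat k}\|\boldsymbol{r}^k\|_2$ (the minimal norm of a perturbation in $\mathcal S$, resp. in $\mathbb{R}^d$, that changes the estimated label; points exactly on the boundary count as label changes). A random $m$-dimensional subspace of $\mathbb{R}^d$ is the span of $m$ independent vectors drawn uniformly from the unit sphere $\mathbb{S}^{d-1}$. For $m\ge1$ and $\delta\in(0,1)$, $\zeta_1(m,\delta)=\Big(1+2\sqrt{\tfrac{\ln(1/\delta)}{m}}+\tfrac{2\ln(1/\delta)}{m}\Big)^{-1}$ and $\zeta_2(m,\delta)=\Big(\max\big(\tfrac1e\delta^{2/m},\,1-\sqrt{2(1-\delta^{2/m})}\big)\Big)^{-1}$.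 *)

(* Defs.v *)
From HB Require Import structures.
From mathcomp Require Import all_boot all_order all_algebra.
From mathcomp Require Import all_classical all_reals all_analysis.
Set Implicit Arguments. Unset Strict Implicit. Unset Printing Implicit Defensive.
Import Order.TTheory GRing.Theory Num.Theory.
Import numFieldNormedType.Exports.
Local Open Scope classical_set_scope.
Local Open Scope ring_scope.

Section Defs.
Variable R : realType.

Definition norm2 (d : nat) (r : 'rV[R]_d) : R :=
  Num.sqrt (\sum_(j < d) r ord0 j ^+ 2).

Definition sphere (d : nat) : set 'rV[R]_d := [set v | norm2 v = 1].

(* Borel sets of R^d (sigma-algebra generated by the open sets of the
   product = Euclidean topology on 'rV[R]_d). *)
Definition borelRd (d : nat) : set (set 'rV[R]_d) :=
  <<s [set A | open A] >>.

(* Affine classifier f(x) = W^T x + b, written with row vectors: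
   f(x) = x *m W + b, so f_k(x) = sum_j x_j W_{j k} + b_k. *)
Definition affine_clf (d L : nat) (W : 'M[R]_(d, L)) (b : 'rV[R]_L)
  (x : 'rV[R]_d) : 'rV[R]_L := x *m W + b.

Definition fk (d L : nat) (W : 'M[R]_(d, L)) (b : 'rV[R]_L)
  (k : 'I_L) (x : 'rV[R]_d) : R := affine_clf W b x ord0 k.

(* || r^k_S ||_2 = inf { ||r||_2 : r in S, f_k(x0+r) >= f_khat(x0+r) },
   inf of the empty set = +oo (extended reals). *)
Definition rk_norm (d L : nat) (W : 'M[R]_(d, L)) (b : 'rV[R]_L)
  (x0 : 'rV[R]_d) (khat : 'I_L) (S : set 'rV[R]_d) (k : 'I_L) : \bar R :=
  ereal_inf [set (norm2 r)%:E | r in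
    [set r | S r /\ fk W b khat (x0 + r) <= fk W b k (x0 + r)]].

Definition rstar_norm (d L : nat) (W : 'M[R]_(d, L)) (b : 'rV[R]_L)
  (x0 : 'rV[R]_d) (khat : 'I_L) (S : set 'rV[R]_d) : \bar R :=
  \big[Order.min/+oo%E]_(k < L | k != khat) rk_norm W b x0 khat S k.

Definition span_rows (d m : nat) (v : 'I_m -> 'rV[R]_d) : set 'rV[R]_d :=
  [set r | (r <= \matrix_(i < m, j < d) v i ord0 j)%MS].

Definition zeta1 (m : nat) (delta : R) : R :=
  (1 + 2 * Num.sqrt (ln (delta^-1) / m%:R) + 2 * ln (delta^-1) / m%:R)^-1.

Definition zeta2 (m : nat) (delta : R) : R :=
  (Num.max ((expR 1)^-1 * delta `^ (2 / m%:R))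
           (1 - Num.sqrt (2 * (1 - delta `^ (2 / m%:R)))))^-1.

Section Random.
Context (d0 : measure_display) (Omega : measurableType d0)
        (P : probability Omega R).

Definition random_vector (d : nat) (X : Omega -> 'rV[R]_d) : Prop :=
  forall B, borelRd B -> measurable (X @^-1` B).

(* X is uniformly distributed on the unit sphere S^{d-1}: its law is a Borel
   probability measure concentrated on S^{d-1} and invariant under every
   orthogonal transformation (this is the (unique) uniform = normalized
   surface measure on the sphere). *)
Definition uniform_on_sphere (d : nat) (X : Omega -> 'rV[R]_d) : Prop :=
  [/\ random_vector X,
      P (X @^-1` @sphere d) = 1%E &
      forall (Q : 'M[R]_d), Q *m Q^T = 1%:M ->
        forall B, borelRd B ->
          P (X @^-1` B) = P ((fun w => X w *m Q) @^-1` B)].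

Definition independent_vectors (d m : nat) (v : 'I_m -> Omega -> 'rV[R]_d)
  : Prop :=
  forall B : 'I_m -> set 'rV[R]_d, (forall i, borelRd (B i)) ->
    P (\bigcap_(i in [set: 'I_m]) (v i @^-1` B i)) =
    (\prod_(i < m) P (v i @^-1` B i))%E.

End Random.
End Defs.

(* Main.v *)
Require Import Defs.
From HB Require Import structures.
From mathcomp Require Import all_boot all_order all_algebra.
From mathcomp Require Import all_classical all_reals all_analysis.
From mathcomp Require Import measurable_realfun ring lra.
Import Order.TTheory GRing.Theory Num.Theory.
Import numFieldNormedType.Exports.
Local Open Scope classical_set_scope.
Local Open Scope ring_scope.

Set Implicit Arguments. Unset Strict Implicit. Unset Printing Implicit Defensive.

(** The distance from [x0] to the [k]-th decision boundary inside a subspace [S]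
is the margin divided by the norm of the orthogonal projection of
[z = w_k - w_khat] on [S], so everything rests on the law of [T = |Pi_S z|^2]
for a unit vector [z].

No Gaussian vector is needed.  With [q(u) = u Pi u^T], rotating [u] by angle [t]
in each coordinate plane leaves [E q(u)^(n+1)] unchanged; the second-order term
in [t], summed over all planes, is the spherical Laplacian of [q^(n+1)] and gives
[(d + 2n) E q^(n+1) = E ((tr Pi + 2n) |u|^2 q^n)].  Applied to a fixed [u = z] and
the random projector, this yields the moments of [T] (those of a
Beta(m/2, (d-m)/2) law) and of [1 - T].  Applied to [u = v_(n+1)] and the
projector on the span of [v_1, ..., v_n], it shows that the moments of
[|Pi v_(n+1)|^2] tend to [0], so that [S] almost surely has dimension [m].

Weighting the moments by the coefficients of [(1 - s x)^(-d/2)] gives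
[E (1 - s T)^(-d/2) = (1 - s)^(-m/2)], and Markov's inequality with [s = 1 - 1/b]
for [T] and [s = 1 - b] for [1 - T] bounds both tails at [b m / d] by
[exp (m/2 (1 - b + ln b))]; a union bound over the classes concludes. *)

(** * Bilinear forms, orthogonal projectors, and sums over coordinate planes *)

Section QuadraticForms.
Variables (R : realType) (d : nat).
Implicit Types (u v w x : 'rV[R]_d) (P Q : 'M[R]_d).

Definition bform P u v : R := (u *m P *m v^T) ord0 ord0.

Lemma bformDl P u v w : bform P (u + v) w = bform P u w + bform P v w.
Proof. by rewrite /bform !mulmxDl mxE. Qed.

Lemma bformDr P u v w : bform P w (u + v) = bform P w u + bform P w v.
Proof. by rewrite /bform linearD mulmxDr mxE. Qed.

Lemma bformZl P a u v : bform P (a *: u) v = a * bform P u v.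
Proof. by rewrite /bform -!scalemxAl mxE. Qed.

Lemma bformZr P a u v : bform P u (a *: v) = a * bform P u v.
Proof. by rewrite /bform linearZ -scalemxAr mxE. Qed.

Lemma bformC P u v : P^T = P -> bform P u v = bform P v u.
Proof.
move=> sP; rewrite /bform -[in LHS](trmxK (u *m P)) -trmx_mul mxE.
by rewrite trmx_mul sP mulmxA.
Qed.

Lemma bformE P u v : bform P u v = \sum_i \sum_j u ord0 i * P i j * v ord0 j.
Proof.
rewrite /bform mxE exchange_big; apply: eq_bigr => j _ /=.
by rewrite !mxE mulr_suml.
Qed.

Lemma bform1E u v : bform 1%:M u v = \sum_j u ord0 j * v ord0 j.
Proof. by rewrite /bform mulmx1 mxE; apply: eq_bigr => j _; rewrite mxE. Qed.

Lemma bformEmx P u v : bform P u v = bform 1%:M (u *m P) v.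
Proof. by rewrite /bform mulmx1. Qed.

Lemma bform1_ge0 u : 0 <= bform 1%:M u u.
Proof. by rewrite bform1E sumr_ge0 // => j _; rewrite -expr2 sqr_ge0. Qed.

Lemma bform1_eq0 u : (bform 1%:M u u == 0) = (u == 0).
Proof.
apply/eqP/eqP => [|->]; last by rewrite /bform !mul0mx mxE.
rewrite bform1E => /eqP; rewrite psumr_eq0 => [/allP u0|j _]; last first.
  by rewrite -expr2 sqr_ge0.
apply/rowP => j; have := u0 j (mem_index_enum j).
by rewrite -expr2 sqrf_eq0 mxE => /eqP.
Qed.

Lemma norm2E u : norm2 u = Num.sqrt (bform 1%:M u u).
Proof. by rewrite /norm2 bform1E. Qed.

Lemma bform1_le1_coord u j : bform 1%:M u u <= 1 -> `|u ord0 j| <= 1.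
Proof.
rewrite bform1E (bigD1 j) //= => h.
have : u ord0 j ^+ 2 <= 1.
  apply: le_trans h; rewrite expr2 lerDl sumr_ge0 // => i _.
  by rewrite -expr2 sqr_ge0.
by rewrite -real_normK ?num_real ?expr_le1.
Qed.

Lemma bform1_CauchySchwarz u v :
  bform 1%:M u v ^+ 2 <= bform 1%:M u u * bform 1%:M v v.
Proof.
have [->|v0] := eqVneq v 0.
  by rewrite /bform trmx0 !mulmx0 mxE expr0n /= mulr0.
have vv : 0 < bform 1%:M v v by rewrite lt0r bform1_eq0 v0 bform1_ge0.
set a := bform 1%:M v v in vv *; set c := bform 1%:M u v.
have := bform1_ge0 (u + (- (c / a)) *: v).
rewrite !(bformDl, bformDr, bformZl, bformZr) -/a -/c.
rewrite (bformC v u (trmx1 _ _)) -/c => h.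
have {}h : 0 <= bform 1%:M u u - c ^+ 2 / a.
  by apply: le_trans h _; rewrite le_eqVlt; apply/orP; left; apply/eqP; field; lra.
by rewrite subr_ge0 ler_pdivrMr in h.
Qed.

Definition orth_proj P := P^T = P /\ P *m P = P.

Lemma orth_projC P : orth_proj P -> orth_proj (1%:M - P).
Proof.
case=> sP pP; split; first by rewrite linearB /= trmx1 sP.
by rewrite mulmxBl mul1mx mulmxBr mulmx1 pP subrr subr0.
Qed.

Lemma orth_proj1 : orth_proj 1%:M.
Proof. by split; rewrite ?trmx1 ?mulmx1. Qed.

Lemma orth_proj_bform P u : orth_proj P ->
  bform P u u = bform 1%:M (u *m P) (u *m P).
Proof.
by case=> sP pP; rewrite /bform mulmx1 trmx_mul sP !mulmxA -(mulmxA u P P) pP.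
Qed.

Lemma orth_proj_bform_ge0 P u : orth_proj P -> 0 <= bform P u u.
Proof. by move=> /orth_proj_bform ->; exact: bform1_ge0. Qed.

Lemma bform_onem P u : bform (1%:M - P) u u = bform 1%:M u u - bform P u u.
Proof. by rewrite /bform mulmxBr mulmxBl mxE [X in _ + X]mxE. Qed.

Lemma orth_proj_bform_le P u : orth_proj P -> bform P u u <= bform 1%:M u u.
Proof.
move=> /orth_projC/(orth_proj_bform_ge0 u).
by rewrite bform_onem subr_ge0.
Qed.

(** The diagonal entry [P i i] is the squared norm of row [i], hence it dominates [P i j ^+ 2] for
    every [j], and [j = i] forces [P i i <= 1]. This bounds the entries of a random projector
    uniformly. *)
Lemma orth_proj_entry P i j : orth_proj P -> `|P i j| <= 1.
Proof.
case=> sP pP.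
have symP a b : P a b = P b a by rewrite -[in LHS]sP mxE.
have ent (a b : 'I_d) : P a b ^+ 2 <= P a a.
  rewrite -[in leRHS]pP mxE (bigD1 b) //= symP -expr2 lerDl.
  by rewrite sumr_ge0 // => c _; rewrite symP -expr2 sqr_ge0.
have P0 : 0 <= P i i by apply: le_trans (ent i i); exact: sqr_ge0.
have P1 : P i i <= 1.
  have := ent i i; rewrite expr2; nra.
by rewrite -(expr_le1 (n := 2)) ?real_normK ?num_real // (le_trans (ent i j)).
Qed.

(** These are the sums over planes from which the spherical Laplacian is assembled. Each double sum
    without its diagonal is the full double sum, which splits into products of single sums, minus
    the diagonal; the diagonal vanishes in the first and third cases. *)
Lemma sum_planes P u : P^T = P -> P *m P = P ->
  let N := bform 1%:M u u in let q := bform P u u in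
  let w := u *m P in
  [/\ \sum_(a < d) \sum_(b < d | b != a)
        (u ord0 a ^+ 2 * P b b + u ord0 b ^+ 2 * P a a
           - 2 * u ord0 a * u ord0 b * P a b) = 2 * (\tr P * N - q),
      \sum_(a < d) \sum_(b < d | b != a)
        (u ord0 a * w ord0 a + u ord0 b * w ord0 b) = 2 * (d%:R - 1) * q &
      \sum_(a < d) \sum_(b < d | b != a)
        (u ord0 a * w ord0 b - u ord0 b * w ord0 a) ^+ 2
        = 2 * (N * q - q ^+ 2)].
Proof.
move=> sP pP N q w.
have NE : N = \sum_a u ord0 a ^+ 2.
  by rewrite /N bform1E; apply: eq_bigr => a _; rewrite expr2.
have qE : q = \sum_a u ord0 a * w ord0 a.
  by rewrite /q bformEmx bform1E; apply: eq_bigr => a _; rewrite mulrC.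
have qE2 : q = \sum_a w ord0 a ^+ 2.
  rewrite /q orth_proj_bform // bform1E.
  by apply: eq_bigr => a _; rewrite expr2.
have trE : \tr P = \sum_a P a a by [].
have full (F : 'I_d -> 'I_d -> R) : \sum_a \sum_(b | b != a) F a b =
    \sum_a \sum_b F a b - \sum_a F a a.
  rewrite -sumrB; apply: eq_bigr => a _.
  by rewrite [in RHS](bigD1 a) //= [F a a + _]addrC addrK.
have prod (F G : 'I_d -> R) :
    \sum_a \sum_b F a * G b = (\sum_a F a) * (\sum_b G b).
  by rewrite mulr_suml; apply: eq_bigr => a _; rewrite mulr_sumr.
have prod' (F G : 'I_d -> R) :
    \sum_a \sum_b F b * G a = (\sum_a F a) * (\sum_b G b).
  by rewrite exchange_big prod.
split.
- rewrite full [X in _ - X]big1 ?subr0; last by move=> a _; ring.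
  have -> : q = \sum_a \sum_b u ord0 a * u ord0 b * P a b.
    rewrite /q bformE; apply: eq_bigr => a _; apply: eq_bigr => b _; ring.
  under eq_bigr do rewrite sumrB big_split /=.
  rewrite sumrB big_split /= prod prod' -trE -NE.
  rewrite (eq_bigr (fun a => 2 * \sum_b u ord0 a * u ord0 b * P a b)).
    rewrite -mulr_sumr; ring.
  by move=> a _; rewrite mulr_sumr; apply: eq_bigr => b _; ring.
- rewrite full.
  under eq_bigr do rewrite big_split /= sumr_const -qE card_ord.
  rewrite big_split /= sumr_const card_ord sumrMnl -qE.
  rewrite big_split /= -qE -mulr_natr; ring.
- rewrite full [X in _ - X]big1 ?subr0; last by move=> a _; ring.
  have -> : \sum_a \sum_b (u ord0 a * w ord0 b - u ord0 b * w ord0 a) ^+ 2 =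
     \sum_a \sum_b (u ord0 a ^+ 2 * w ord0 b ^+ 2 + u ord0 b ^+ 2 * w ord0 a ^+ 2
       + (u ord0 a * w ord0 a) * ((-2) * (u ord0 b * w ord0 b))).
    by apply: eq_bigr => a _; apply: eq_bigr => b _; ring.
  under eq_bigr do rewrite 2!big_split /=.
  rewrite 2!big_split /= !prod prod' -mulr_sumr -qE -NE -qE2; ring.
Qed.

End QuadraticForms.

(** * Rotations of a coordinate plane with a rational parameter *)

Section PlaneRotation.
Variables (R : realType) (d : nat) (a b : 'I_d).
Hypothesis ab : b != a.

Let D : 'M[R]_d := delta_mx a a + delta_mx b b.
Let A : 'M[R]_d := delta_mx a b - delta_mx b a.

(* cos = (1 - t^2) / (1 + t^2) and sin = 2t / (1 + t^2), so that everything
   is rational in t *)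
Definition plane_rot (t : R) : 'M[R]_d :=
  1%:M + (- (2 * t ^+ 2) / (1 + t ^+ 2)) *: D + (2 * t / (1 + t ^+ 2)) *: A.

Let DD : D *m D = D.
Proof.
rewrite /D mulmxDl !mulmxDr !mul_delta_mx_cond !eqxx [a == b]eq_sym (negbTE ab).
by rewrite !mulr0n !mulr1n addr0 add0r.
Qed.

Let DA : D *m A = A.
Proof.
rewrite /D /A mulmxDl !mulmxBr !mul_delta_mx_cond !eqxx [a == b]eq_sym (negbTE ab).
by rewrite !mulr0n !mulr1n subr0 add0r.
Qed.

Let AD : A *m D = A.
Proof.
rewrite /D /A mulmxBl !mulmxDr !mul_delta_mx_cond !eqxx [a == b]eq_sym (negbTE ab).
by rewrite !mulr0n !mulr1n addr0 add0r.
Qed.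

Let AA : A *m A = - D.
Proof.
rewrite /D /A mulmxBl !mulmxBr !mul_delta_mx_cond !eqxx [a == b]eq_sym (negbTE ab).
by rewrite !mulr0n !mulr1n subr0 sub0r opprD.
Qed.

Lemma plane_rot_orth t : plane_rot t *m (plane_rot t)^T = 1%:M.
Proof.
have t1 : 1 + t ^+ 2 != 0 by rewrite gt_eqF // ltr_pwDl // sqr_ge0.
have trD : D^T = D by rewrite /D linearD /= !trmx_delta.
have trA : A^T = - A by rewrite /A linearB /= !trmx_delta opprB.
rewrite /plane_rot; set c := - _ / _; set s := _ / _.
have tD (X Y : 'M[R]_d) : (X + Y)^T = X^T + Y^T by exact: linearD.
have tZ k (X : 'M[R]_d) : (k *: X)^T = k *: X^T by exact: linearZ.
rewrite 2!tD 2!tZ trmx1 trD trA.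
rewrite !mulmxDl !mulmxDr !mul1mx !mulmx1 -!scalemxAl -!scalemxAr !scalerA.
rewrite !(mulmxN, mulNmx) DD DA AD AA !scalerN opprK.
(* Here [1 + c] is the cosine and [s] the sine, so [(1 + c)^2 + s^2 = 1] and the added multiple of
   [D] is zero. *)
have {2}-> : 1%:M = 1%:M + (2 * c + c ^+ 2 + s ^+ 2) *: D :> 'M[R]_d.
  rewrite (_ : _ + _ + _ = 0) ?scale0r ?addr0 //.
  by rewrite /c /s; field.
by apply/matrixP => i j; rewrite !mxE; ring.
Qed.

Let uD (u : 'rV[R]_d) : u *m D = u ord0 a *: delta_mx 0 a + u ord0 b *: delta_mx 0 b.
Proof.
rewrite /D mulmxDr; congr (_ + _); apply/rowP => j; rewrite !mxE.
  rewrite (bigD1 a) //= big1 ?addr0 ?mxE ?eqxx //.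
  by move=> i ia; rewrite mxE (negbTE ia) mulr0.
rewrite (bigD1 b) //= big1 ?addr0 ?mxE ?eqxx //.
by move=> i ia; rewrite mxE (negbTE ia) mulr0.
Qed.

Let uA (u : 'rV[R]_d) : u *m A = u ord0 a *: delta_mx 0 b + (- u ord0 b) *: delta_mx 0 a.
Proof.
rewrite /A mulmxBr scaleNr; congr (_ - _); apply/rowP => j; rewrite !mxE.
  rewrite (bigD1 a) //= big1 ?addr0 ?mxE ?eqxx //.
  by move=> i ia; rewrite mxE (negbTE ia) mulr0.
rewrite (bigD1 b) //= big1 ?addr0 ?mxE ?eqxx //.
by move=> i ia; rewrite mxE (negbTE ia) mulr0.
Qed.

Let be (P : 'M[R]_d) u i : bform P u (delta_mx 0 i) = (u *m P) ord0 i.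
Proof.
rewrite /bform mxE (bigD1 i) //= big1 ?addr0 ?mxE ?eqxx ?mulr1 //.
by move=> j ji; rewrite !mxE (negbTE ji) andbF mulr0.
Qed.

Let ee (P : 'M[R]_d) i j : bform P (delta_mx 0 i) (delta_mx 0 j) = P i j.
Proof. by rewrite be -rowE mxE. Qed.

(** Clearing the denominator turns the rotated energy into a polynomial of degree at most 4 in [t].
    In the names, [π] stands for [u *m D], the projection of [u] on the plane, and [α] for [u *m A],
    its quarter turn. *)
Lemma bform_plane_rot (P : 'M[R]_d) (u : 'rV[R]_d) (t : R) : P^T = P ->
  let q := bform P u u in let w := u *m P in
  let ua := u ord0 a in let ub := u ord0 b in
  let wa := w ord0 a in let wb := w ord0 b in
  let Buα := ua * wb - ub * wa in
  let Buπ := ua * wa + ub * wb in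
  let Bαα := ua ^+ 2 * P b b + ub ^+ 2 * P a a - 2 * ua * ub * P a b in
  let Bππ := ua ^+ 2 * P a a + ub ^+ 2 * P b b + 2 * ua * ub * P a b in
  let Bαπ := (ua ^+ 2 - ub ^+ 2) * P a b + ua * ub * (P b b - P a a) in
  bform P (u *m plane_rot t) (u *m plane_rot t) * (1 + t ^+ 2) ^+ 2 =
  q + 4 * Buα * t + (2 * q + 4 * Bαα - 4 * Buπ) * t ^+ 2
  + (4 * Buα - 8 * Bαπ) * t ^+ 3 + (q + 4 * Bππ - 4 * Buπ) * t ^+ 4.
Proof.
move=> sP /=.
have t1 : 1 + t ^+ 2 != 0 by rewrite gt_eqF // ltr_pwDl // sqr_ge0.
have Pba : P b a = P a b by rewrite -[in LHS]sP mxE.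
rewrite /plane_rot !mulmxDr mulmx1 -!scalemxAr uD uA.
rewrite !(bformDl, bformDr, bformZl, bformZr).
have eb i : bform P (delta_mx 0 i) u = (u *m P) ord0 i by rewrite bformC ?be.
rewrite !ee !be !eb Pba.
by field.
Qed.

End PlaneRotation.

(** * The orthogonal projector on a span, built by Gram-Schmidt *)

Section GramSchmidt.
Variables (R : realType) (d : nat).
Implicit Types (x : nat -> 'rV[R]_d) (P Q : 'M[R]_d) (u y r : 'rV[R]_d).

(* A dependent vector contributes nothing, because 0^-1 = 0. *)
Fixpoint gsproj x n : 'M[R]_d :=
  if n is k.+1 then
    let P := gsproj x k in let r := x k *m (1%:M - P) in
    P + (bform 1%:M r r)^-1 *: (r^T *m r)
  else 0.

Lemma mulmx_bform1 u y : u *m y^T = (bform 1%:M u y)%:M.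
Proof. by rewrite /bform mulmx1 [LHS]mx11_scalar. Qed.

Lemma trmx_onem P : P^T = P -> (1%:M - P)^T = 1%:M - P.
Proof. by move=> sP; rewrite linearB /= trmx1 sP. Qed.

Lemma gsproj_orth x n : orth_proj (gsproj x n).
Proof.
elim: n => [|n [sP pP]] /=; first by split; rewrite ?trmx0 ?mul0mx.
set P := gsproj x n in sP pP *; set r := x n *m _.
have rP : r *m P = 0 by rewrite /r -mulmxA mulmxBl mul1mx pP subrr mulmx0.
have Pr : P *m r^T = 0 by rewrite -sP -trmx_mul rP trmx0.
clearbody r; set c := bform _ r r.
split; first by rewrite linearD linearZ /= trmx_mul trmxK sP.
rewrite mulmxDl !mulmxDr pP -!scalemxAl -!scalemxAr !mulmxA Pr mul0mx.
rewrite -(mulmxA r^T r P) rP mulmx0 !scaler0 addr0 add0r; congr (_ + _).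
rewrite -(mulmxA r^T r r^T) mulmx_bform1 -/c mul_mx_scalar -scalemxAl !scalerA.
have [->|c0] := eqVneq c 0; first by rewrite invr0 !mul0r.
by rewrite mulVf ?mulr1.
Qed.

Lemma gsproj_residual x n : let r := x n *m (1%:M - gsproj x n) in
  x n *m r^T = (bform 1%:M r r)%:M.
Proof.
move=> r; have [sP pP] := orth_projC (gsproj_orth x n).
by rewrite -mulmx_bform1 /r trmx_mul sP !mulmxA -(mulmxA (x n) _ (1%:M - _)) pP.
Qed.

Lemma gsproj_fixS x n u : u *m gsproj x n = u -> u *m gsproj x n.+1 = u.
Proof.
move=> uP /=; set r := x n *m _; have [sP pP] := gsproj_orth x n.
rewrite mulmxDr uP -scalemxAr mulmxA.
suff -> : u *m r^T = 0 by rewrite mul0mx scaler0 addr0.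
by rewrite /r trmx_mul trmx_onem // mulmxA mulmxBr mulmx1 uP subrr mul0mx.
Qed.

Lemma gsproj_fix x n i : (i < n)%N -> x i *m gsproj x n = x i.
Proof.
elim: n => // n IH; rewrite ltnS leq_eqVlt => /predU1P[->|/IH]; last first.
  exact: gsproj_fixS.
have /= := gsproj_residual x n; set r := x n *m (1%:M - _) => xr.
rewrite /= -/r mulmxDr -scalemxAr mulmxA xr mul_scalar_mx scalerA.
(* A zero residual means that [x n] is already fixed by the previous projector. *)
have [c0|c0] := eqVneq (bform 1%:M r r) 0.
  rewrite c0 mulr0 scale0r addr0; move/eqP: c0; rewrite bform1_eq0 => /eqP.
  by rewrite /r mulmxBr mulmx1 => /eqP; rewrite subr_eq0 => /eqP.
by rewrite mulVf // scale1r /r mulmxBr mulmx1 addrC subrK.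
Qed.

(** Every generator is fixed by the projector, and by induction the rows of the projector are
    combinations of the generators. No linear independence enters. *)
Lemma gsproj_span x n (V : 'M[R]_(n, d)) :
  (forall i : 'I_n, row i V = x i) ->
  forall u, (u <= V)%MS = (u *m gsproj x n == u).
Proof.
move=> VE u; apply/idP/eqP => [/submxP[c ->]|<-].
  rewrite -mulmxA; congr (_ *m _); apply/row_matrixP => i.
  by rewrite row_mul VE gsproj_fix.
apply: mulmx_sub.
suff sub k : (k <= n)%N -> (gsproj x k <= V)%MS by exact: sub.
elim: k => [|k IH] kn /=; first exact: sub0mx.
have {}IH := IH (ltnW kn); rewrite addmx_sub // scalemx_sub // mulmx_sub //.
rewrite mulmxBr mulmx1 addmx_sub ?eqmx_opp ?mulmx_sub //.
by rewrite -(VE (Ordinal kn)) row_sub.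
Qed.

(** The added rank-one matrix has trace 1 unless the residual vanishes, and the squared norm of the
    residual is the difference of the two forms. The trace thus counts the dimension of the span. *)
Lemma gsproj_trS x n : \tr (gsproj x n.+1) =
  \tr (gsproj x n) + (bform 1%:M (x n) (x n) != bform (gsproj x n) (x n) (x n))%:R.
Proof.
rewrite /=; set r := x n *m _; rewrite mxtraceD mxtraceZ mxtrace_mulC mulmx_bform1.
rewrite mxtrace_scalar mulr1n -subr_eq0 -bform_onem.
rewrite (orth_proj_bform _ (orth_projC (gsproj_orth x n))) -/r.
by have [->|c0] := eqVneq; rewrite ?mulr0 // mulVf.
Qed.

Lemma gsproj_tr_le x n : \tr (gsproj x n) <= n%:R.
Proof.
elim: n => [|n IH]; first by rewrite /= mxtrace0.
by rewrite gsproj_trS -natr1 lerD // lern1 leq_b1.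
Qed.

(** Each residual rotates along with its vector and keeps its norm. This equivariance later trades a
    rotation of a fixed vector for a rotation of all generators. *)
Lemma gsproj_rot x Q n : Q *m Q^T = 1%:M ->
  gsproj (fun i => x i *m Q) n = Q^T *m gsproj x n *m Q.
Proof.
move=> QQ; have QQ' : Q^T *m Q = 1%:M by apply/mulmx1C.
elim: n => [|n /= ->]; first by rewrite /= mulmx0 mul0mx.
set P := gsproj x n; set r := x n *m (1%:M - P).
have -> : x n *m Q *m (1%:M - Q^T *m P *m Q) = r *m Q.
  by rewrite /r !(mulmxBr, mulmxBl) !mulmx1 !mulmxA -(mulmxA (x n)) QQ mulmx1.
have -> : bform 1%:M (r *m Q) (r *m Q) = bform 1%:M r r.
  by rewrite /bform !mulmx1 trmx_mul mulmxA -(mulmxA r) QQ mulmx1.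
by rewrite mulmxDr mulmxDl -scalemxAr -scalemxAl trmx_mul !mulmxA.
Qed.

Lemma eq_gsproj x x' n : (forall i, (i < n)%N -> x i = x' i) ->
  gsproj x n = gsproj x' n.
Proof.
elim: n => //= n IH e; rewrite (IH _) ?e // => i i_lt.
by rewrite e // (ltn_trans i_lt).
Qed.

End GramSchmidt.

(** * Distances to the decision boundaries inside a subspace *)

Section Robustness.
Variables (R : realType) (d L : nat) (W : 'M[R]_(d, L)) (b : 'rV[R]_L).
Variables (x0 : 'rV[R]_d) (khat : 'I_L).
Implicit Types (P : 'M[R]_d) (S : set 'rV[R]_d) (k : 'I_L).

Definition margin k : R := fk W b khat x0 - fk W b k x0.

Definition direction k : 'rV[R]_d := (col k W - col khat W)^T.

Lemma fk_shift k r : (fk W b khat (x0 + r) <= fk W b k (x0 + r)) =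
  (margin k <= bform 1%:M r (direction k)).
Proof.
have fkD l : fk W b l (x0 + r) = fk W b l x0 + \sum_j r ord0 j * W j l.
  rewrite /fk /affine_clf mulmxDl !mxE -!addrA; congr (_ + _).
  by rewrite addrC.
rewrite /margin !fkD bform1E.
rewrite [in RHS](eq_bigr (fun j => r ord0 j * W j k - r ord0 j * W j khat)).
  by rewrite sumrB -subr_ge0 -[in RHS]subr_ge0; congr (0 <= _); ring.
by move=> j _; rewrite !mxE; ring.
Qed.

(** Here [a] is the margin and [q] the squared norm of the projected direction. When [q] is 0 no
    perturbation in the subspace reaches the boundary, which matches the infimum of the empty
    set. *)
Definition dist_of_energy (a q : R) : \bar R :=
  if q == 0 then +oo%E else (a / Num.sqrt q)%:E.

(** On [S] the constraint only sees the projection of [z], so Cauchy-Schwarz bounds the norm from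
    below, with equality for a multiple of that projection. *)
Lemma rk_normE P S k : orth_proj P -> (forall r, S r <-> r *m P = r) ->
  0 < margin k ->
  rk_norm W b x0 khat S k =
  dist_of_energy (margin k) (bform P (direction k) (direction k)).
Proof.
move=> oP SP a0; rewrite /rk_norm /dist_of_energy.
set z := direction k; set a := margin k in a0 *; set q := bform P z z.
have q0 : 0 <= q by exact: orth_proj_bform_ge0.
have [sP pP] := oP.
have CS r : S r -> bform 1%:M r z ^+ 2 <= bform 1%:M r r * q.
  move=> /SP rP; rewrite /q (orth_proj_bform z oP).
  have -> : bform 1%:M r z = bform 1%:M r (z *m P); last exact: bform1_CauchySchwarz.
  by rewrite /bform !mulmx1 trmx_mul sP mulmxA rP.
have [qz|qn] := eqVneq q 0.
  rewrite (_ : [set _ | _ in _] = set0) ?ereal_inf0 //.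
  rewrite -subset0 => y [r [Sr]]; rewrite fk_shift -/z -/a => ar _ /=.
  by have := CS r Sr; rewrite qz mulr0; apply/negP; rewrite -ltNge; nra.
have {}q0 : 0 < q by rewrite lt0r qn.
have sq0 : 0 < Num.sqrt q by rewrite sqrtr_gt0.
apply/eqP; rewrite eq_le; apply/andP; split; last first.
  apply: le_ereal_inf_tmp => y [r [Sr]]; rewrite fk_shift -/z -/a => ar <-.
  rewrite lee_fin ler_pdivrMr // norm2E -sqrtrM ?bform1_ge0 //.
  rewrite -[leLHS]gtr0_norm // -sqrtr_sqr ler_wsqrtr //.
  by apply: le_trans (CS r Sr); rewrite ler_sqr ?nnegrE //; lra.
(* The witness is the point of smallest norm in [S] on the hyperplane where the form with [z] equals
   [a]. *)
apply: ereal_inf_lbound; exists ((a / q) *: (z *m P)).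
  split; first by apply/SP; rewrite -scalemxAl -mulmxA pP.
  rewrite fk_shift -/z -/a bformZl -bformEmx -/q.
  by rewrite divfK.
rewrite norm2E bformZl bformZr -orth_proj_bform // -/q.
have -> : a / q * (a / q * q) = (a / Num.sqrt q) ^+ 2.
  by rewrite expr_div_n sqr_sqrtr ?(ltW q0) //; field.
by rewrite sqrtr_sqr gtr0_norm ?divr_gt0.
Qed.

Lemma dist_of_energy_ratio (a q N lo hi : R) : 0 < a -> 0 < N -> 0 < lo ->
  0 < hi -> lo * N <= q -> q <= hi * N ->
  ((Num.sqrt hi)^-1%:E * dist_of_energy a N <= dist_of_energy a q)%E /\
  (dist_of_energy a q <= (Num.sqrt lo)^-1%:E * dist_of_energy a N)%E.
Proof.
move=> a0 N0 lo0 hi0 loq qhi.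
have q0 : 0 < q by apply: lt_le_trans loq; rewrite mulr_gt0.
rewrite /dist_of_energy !gt_eqF //.
rewrite -!EFinM !lee_fin; split; rewrite mulrCA -invfM -sqrtrM ?(ltW hi0, ltW lo0) //.
  by rewrite ler_pM2l // lef_pV2 ?posrE ?sqrtr_gt0 ?mulr_gt0 ?ler_wsqrtr.
by rewrite ler_pM2l // lef_pV2 ?posrE ?sqrtr_gt0 ?mulr_gt0 ?ler_wsqrtr.
Qed.

(** Positive constants are monotone multipliers and fix [+oo], the value of the empty minimum; this
    covers a classifier with a single class. *)
Lemma bigmin_scale_le (I : Type) (s : seq I) (Q : pred I) (F G : I -> \bar R)
    (c1 c2 : R) : 0 < c1 -> 0 < c2 ->
  (forall i, Q i -> (c1%:E * F i <= G i)%E /\ (G i <= c2%:E * F i)%E) ->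
  (c1%:E * \big[Order.min/+oo]_(i <- s | Q i) F i
     <= \big[Order.min/+oo]_(i <- s | Q i) G i)%E /\
  (\big[Order.min/+oo]_(i <- s | Q i) G i
     <= c2%:E * \big[Order.min/+oo]_(i <- s | Q i) F i)%E.
Proof.
move=> c10 c20 FG.
elim/big_ind2 : _ => [|x y x' y' [xy1 xy2] [xy1' xy2']|i Qi]; last exact: FG.
- by rewrite !gt0_muley ?lte_fin // lexx.
- split.
    rewrite le_min; apply/andP; split.
      by apply: le_trans xy1; rewrite lee_pmul2l ?ge_min ?lexx.
    by apply: le_trans xy1'; rewrite lee_pmul2l ?ge_min ?lexx ?orbT.
  have [_|_] := leP y y'.
    by apply: le_trans xy2; rewrite ge_min lexx.
  by apply: le_trans xy2'; rewrite ge_min lexx orbT.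
Qed.

(** This is the deterministic half of the argument: the whole space is the case of the projector
    [1%:M], with energy the squared norm of [z]. Distance decreases with energy, so [hi] controls
    the lower bound and [lo] the upper one. *)
Lemma rstar_norm_bounds P S (lo hi : R) : orth_proj P ->
  (forall r, S r <-> r *m P = r) -> 0 < lo -> 0 < hi ->
  (forall k, k != khat -> 0 < margin k) ->
  (forall k, k != khat -> direction k != 0) ->
  (forall k, k != khat ->
     let z := direction k in
     lo * bform 1%:M z z <= bform P z z /\ bform P z z <= hi * bform 1%:M z z) ->
  ((Num.sqrt hi)^-1%:E * rstar_norm W b x0 khat setT
     <= rstar_norm W b x0 khat S)%E /\
  (rstar_norm W b x0 khat S
     <= (Num.sqrt lo)^-1%:E * rstar_norm W b x0 khat setT)%E.
Proof.
move=> oP SP lo0 hi0 a0 z0 qb.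
apply: bigmin_scale_le; rewrite ?invr_gt0 ?sqrtr_gt0 // => k kk.
rewrite (rk_normE oP SP) ?a0 // (rk_normE (@orth_proj1 R d)) ?a0 //; last first.
  by move=> r; rewrite mulmx1.
have [h1 h2] := qb _ kk; apply: dist_of_energy_ratio => //; first exact: a0.
by rewrite lt0r bform1_ge0 bform1_eq0 z0.
Qed.

End Robustness.

(** * Partial sums of the binomial series of [(1 - x)^(-a)] *)

Section BinomialSeries.
Variable R : realType.
Implicit Types (a x : R) (N : nat).

(** The coefficient of [x^k] in [(1 - x)^(-a)], namely the rising factorial
    [a (a + 1) ... (a + k - 1)] over [k!]. *)
Definition bcoef a k : R := \prod_(j < k) ((a + j%:R) / j.+1%:R).

Definition bsum a N : {poly R} := \poly_(k < N) bcoef a k.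

Lemma bcoefS a k : bcoef a k.+1 * k.+1%:R = bcoef a k * (a + k%:R).
Proof. by rewrite /bcoef big_ord_recr /= -mulrA divfK // pnatr_eq0. Qed.

Lemma bcoef_ge0 a k : 0 <= a -> 0 <= bcoef a k.
Proof. by move=> a0; apply: prodr_ge0 => j _; rewrite divr_ge0 ?addr_ge0. Qed.

(** Coefficientwise form of the fact that [(1 - x)^(-a)] has derivative [a (1 - x)^(-(a + 1))]. *)
Lemma bcoef_shift a k : bcoef a k.+1 * k.+1%:R = a * bcoef (a + 1) k.
Proof.
elim: k => [|k IH]; first by rewrite bcoefS /bcoef !big_ord0 addr0 mulrC.
rewrite bcoefS; apply: (mulIf (x := k.+1%:R)); first by rewrite pnatr_eq0.
rewrite -[RHS]mulrA bcoefS mulrAC IH -natr1; ring.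
Qed.

Lemma bsumE a N x : (bsum a N).[x] = \sum_(k < N) bcoef a k * x ^+ k.
Proof. by rewrite horner_poly. Qed.

Lemma bsumS a N : bsum a N.+1 = bsum a N + bcoef a N *: 'X^N.
Proof. by rewrite /bsum !poly_def big_ord_recr. Qed.

(** The full series solves [(1 - x) y' = a y]; truncation leaves a single term of top degree. *)
Lemma bsum_ode a N x : (1 - x) * (bsum a N.+1)^`().[x] =
  a * (bsum a N.+1).[x] - N.+1%:R * bcoef a N.+1 * x ^+ N.
Proof.
elim: N => [|N IH].
  rewrite bsumS /bsum poly_def big_ord0 add0r expr0 alg_polyC derivC !hornerE.
  by rewrite -[bcoef a 1]mulr1 (bcoefS a 0); ring.
rewrite bsumS derivD hornerD mulrDr IH derivZ derivXn hornerD !hornerE.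
rewrite [N.+2%:R * _]mulrC bcoefS hornerMn hornerXn /= -mulr_natr exprS; ring.
Qed.

Lemma is_derive_bsum a N x : x < 1 ->
  is_derive x 1 (fun y => (bsum a N.+1).[y] * (1 - y) `^ a)
    (- (N.+1%:R * bcoef a N.+1 * x ^+ N * (1 - x) `^ (a - 1))).
Proof.
move=> x1; have y0 : 0 < 1 - x by rewrite subr_gt0.
have d1 : is_derive x 1 (fun y : R => 1 - y) (-1).
  by apply: is_derive_eq; rewrite add0r mul1r.
have d2 : is_derive x 1 (fun y : R => (1 - y) `^ a) (- (a * (1 - x) `^ (a - 1))).
  have := @is_derive1_comp R (fun y : R => y `^ a) (fun y : R => 1 - y) x _ _
    (is_derive1_powR a y0) d1.
  by rewrite mulrN1.
have d3 := is_deriveM (is_derive_poly (bsum a N.+1) x) d2.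
apply: (@is_derive_eq _ _ _ _ _ _ _ _ d3).
have e : (1 - x) `^ a = (1 - x) * (1 - x) `^ (a - 1).
  rewrite -{2}(@powRr1 _ (1 - x)) ?ltW // -powRD ?(gt_eqF y0) ?implybT //.
  by congr (_ `^ _); ring.
have := bsum_ode a N x; rewrite e /GRing.scale /=.
set p := _^`().[x]; set q := (bsum _ _).[x]; set r := _ `^ _ => h.
transitivity (r * ((1 - x) * p - a * q)); first by ring.
by rewrite h; ring.
Qed.

(** The product with [(1 - x)^a] equals 1 at 0, and its derivative is only the truncation term, so
    the mean value theorem yields an explicit remainder. *)
Lemma bsum_MVT a N x : 0 <= x -> x < 1 -> exists2 c, 0 <= c <= x &
  1 - (bsum a N.+1).[x] * (1 - x) `^ a =
  N.+1%:R * bcoef a N.+1 * c ^+ N * (1 - c) `^ (a - 1) * x.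
Proof.
move=> x0 x1; set f := fun y => (bsum a N.+1).[y] * (1 - y) `^ a.
pose df (y : R) := - (N.+1%:R * bcoef a N.+1 * y ^+ N * (1 - y) `^ (a - 1)).
have fd (y : R) : y < 1 -> is_derive y 1 f (df y) by exact: is_derive_bsum.
have [y| |c /[!in_itv]/= c01] := @MVT_segment R f df 0 x x0.
- by rewrite in_itv => /andP[_ yx]; apply: fd; exact: lt_trans yx x1.
- apply: derivable_within_continuous => y; rewrite in_itv /= => /andP[_ yx].
  exact: (@ex_derive _ _ _ _ _ _ _ (fd _ (le_lt_trans yx x1))).
rewrite subr0 => fE; exists c => //.
have f0 : f 0 = 1.
  rewrite /f subr0 powR1 mulr1 bsumE big_ord_recl /bcoef big_ord0 expr0 mulr1.
  by rewrite big1 ?addr0 // => i _; rewrite exprS mul0r mulr0.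
by rewrite f0 in fE; rewrite -[LHS]opprB fE /df mulNr opprK.
Qed.

Lemma bsum_ub a N x : 0 <= a -> 0 <= x -> x < 1 ->
  (bsum a N).[x] * (1 - x) `^ a <= 1.
Proof.
move=> a0 x0 x1; case: N => [|N].
  by rewrite bsumE big_ord0 mul0r ler01.
have [c /andP[c0 _] e] := bsum_MVT a N x0 x1.
rewrite -subr_ge0 e; do !apply: mulr_ge0 => //; rewrite ?powR_ge0 //.
- exact: bcoef_ge0.
- exact: exprn_ge0.
Qed.

(** In the remainder, [1 <= a] gives [(1 - c)^(a - 1) <= 1], and [c <= x] bounds the power of
    [c]. *)
Lemma bsum_lb a N x : 1 <= a -> 0 <= x -> x < 1 ->
  1 - N.+1%:R * bcoef a N.+1 * x ^+ N.+1 <= (bsum a N.+1).[x] * (1 - x) `^ a.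
Proof.
move=> a1 x0 x1; have [c /andP[c0 cx] e] := bsum_MVT a N x0 x1.
rewrite lerBlDr -lerBlDl e exprSr mulrA ler_wpM2r // -!mulrA.
rewrite !ler_wpM2l ?bcoef_ge0 ?(le_trans _ a1) //.
rewrite -[leRHS]mulr1; apply: ler_pM; rewrite ?exprn_ge0 ?powR_ge0 ?lerXn2r ?nnegrE //.
have c1 : 0 < 1 - c by rewrite subr_gt0 (le_lt_trans cx).
rewrite -[leRHS](powRr0 (1 - c)); apply: ger_powR; last by rewrite subr_ge0.
by rewrite c1 lerBlDr lerDl.
Qed.

(** If the remainder stayed above [e], then by [bcoef_shift] every term of the series with parameter
    [a + 1] would exceed a fixed positive amount, against the bound [bsum_ub] on its partial
    sums. *)
Lemma bsum_remainder a x e : 0 <= a -> 0 <= x -> x < 1 -> 0 < e ->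
  exists N, N.+1%:R * bcoef a N.+1 * x ^+ N.+1 < e.
Proof.
move=> a0 x0 x1 e0; apply: contrapT => /forallNP h.
have {}h N : e <= a * x * (bcoef (a + 1) N * x ^+ N).
  have /negP := h N; rewrite -leNgt => /le_trans; apply.
  by rewrite [N.+1%:R * _]mulrC bcoef_shift exprS; lra.
have a10 : 0 <= a + 1 by lra.
set C := ((1 - x) `^ (a + 1))^-1.
have y0 : 0 < (1 - x) `^ (a + 1) by rewrite powR_gt0 // subr_gt0.
have bnd N : e *+ N <= a * x * C.
  apply: (@le_trans _ _ (a * x * (bsum (a + 1) N).[x])).
    rewrite bsumE mulr_sumr -[X in e *+ X]card_ord -sumr_const.
    by apply: ler_sum => k _; exact: h.
  rewrite ler_wpM2l ?mulr_ge0 // /C -[leRHS]mul1r ler_pdivlMr //.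
  exact: bsum_ub.
have := bnd (Num.bound (a * x * C / e)); rewrite -mulr_natr; apply/negP.
rewrite -ltNge -ltr_pdivrMl // mulrC; apply: archi_boundP.
by rewrite divr_ge0 ?mulr_ge0 ?invr_ge0 ?(ltW e0) ?(ltW y0).
Qed.

(* Turns a bound on all partial sums into one on (1 - x)^(-a). *)
Lemma bsum_limit_le a x p K : 1 <= a -> 0 <= x -> x < 1 -> 0 <= p ->
  (forall N, p * (bsum a N).[x] <= K) -> p <= K * (1 - x) `^ a.
Proof.
move=> a1 x0 x1 p0 h; apply/ler_addgt0Pr => e e0.
(* Dividing by [p + 1] instead of [p] covers the case [p = 0]. *)
have e1 : 0 < e / (p + 1) by rewrite divr_gt0 // ltr_wpDl.
have [N hN] := @bsum_remainder a x _ (le_trans ler01 a1) x0 x1 e1.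
have l := bsum_lb N a1 x0 x1.
have l2 := ler_wpM2r (powR_ge0 (1 - x) a) (h N.+1).
have l3 := ler_wpM2l p0 l.
have l4 : p * (N.+1%:R * bcoef a N.+1 * x ^+ N.+1) <= e.
  apply: (@le_trans _ _ (p * (e / (p + 1)))); first by rewrite ler_wpM2l // ltW.
  by rewrite mulrCA ler_piMr ?(ltW e0) // ler_pdivrMr ?ltr_wpDl // mul1r lerDl.
move: l2 l3 l4; rewrite mulrBr mulr1 !mulrA; lra.
Qed.

End BinomialSeries.

(** * The Chernoff exponent and its comparison with [zeta1] and [zeta2] *)

Section ChernoffExponents.
Variable R : realType.
Implicit Types (b n p : R).

(** The first factor is [exp (p ln b)], and [1 - y <= exp (- y)] turns the second into
    [exp (- (b - 1) p)]. The condition [b * p / n <= 1] keeps the base nonnegative. *)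
Lemma upper_exponent b n p : 1 <= b -> 0 < n -> 0 < p -> b * p / n <= 1 ->
  (b^-1 `^ p)^-1 * (1 - (1 - b^-1) * (b * p / n)) `^ n
    <= expR (p * (1 - b + ln b)).
Proof.
move=> b1 n0 p0 c1; have b0 : 0 < b by exact: lt_le_trans b1.
set s := 1 - b^-1.
have bV0 : 0 < b^-1 by rewrite invr_gt0.
have s0 : 0 <= s by rewrite subr_ge0 invf_le1.
have s1 : s < 1 by rewrite /s ltrBlDr ltrDl.
have sc : s * (b * p / n) * n = (b - 1) * p by rewrite /s; field; lra.
have sc1 : 0 <= 1 - s * (b * p / n).
  rewrite subr_ge0; apply: mulr_ile1 => //; last exact: ltW.
  by rewrite divr_ge0 ?mulr_ge0 // ltW.
apply: (@le_trans _ _ (((b^-1) `^ p)^-1 * expR (- (s * (b * p / n))) `^ n)).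
  rewrite ler_wpM2l ?invr_ge0 ?powR_ge0 //.
  apply: ge0_ler_powR; rewrite ?nnegrE ?expR_ge0 ?(ltW n0) //.
  exact: expR_ge1Dx.
rewrite -expRM /powR gt_eqF // lnV ?posrE // -expRN -expRD ler_expR.
by rewrite mulNr sc; lra.
Qed.

(** This is the shape of the tail bound for the complementary projector, with parameter [n - p] and
    threshold [1 - b p / n]. Extracting a factor [b] from the base leaves [b^n / b^(n - p) = b^p],
    and [1 + y <= exp y] handles the rest. *)
Lemma lower_exponent b n p : 0 < b <= 1 -> 0 < p <= n ->
  (b `^ (n - p))^-1 * (1 - (1 - b) * (1 - b * p / n)) `^ n
    <= expR (p * (1 - b + ln b)).
Proof.
move=> /andP[b0 b1] /andP[p0 pn]; have n0 : 0 < n by exact: lt_le_trans pn.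
pose s := 1 - b; rewrite -/s.
have -> : 1 - s * (1 - b * p / n) = b * (1 + s * p / n) by rewrite /s; field; lra.
have s0 : 0 <= s by rewrite subr_ge0.
have q0 : 0 <= s * p / n by rewrite divr_ge0 ?mulr_ge0 // ltW.
rewrite powRM ?(ltW b0) ?addr_ge0 //.
apply: (@le_trans _ _ ((b `^ (n - p))^-1 * (b `^ n * expR (s * p / n) `^ n))).
  rewrite !ler_wpM2l ?invr_ge0 ?powR_ge0 //.
  apply: ge0_ler_powR; rewrite ?nnegrE ?expR_ge0 ?(ltW n0) ?addr_ge0 //.
  exact: expR_ge1Dx.
rewrite -expRM /powR gt_eqF // -expRN -!expRD ler_expR divfK ?gt_eqF //.
by rewrite /s; lra.
Qed.

Lemma expR_ge_quadratic (x : R) : 0 <= x -> 1 + x + x ^+ 2 / 2 <= expR x.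
Proof.
move=> x0.
have df (y : R) : is_derive y 1 (fun y : R => expR y - (y + y ^+ 2 / 2))
    (expR y - (1 + y)).
  apply: is_derive_eq.
  by rewrite /GRing.scale /= ?expr1 -mulr_natr; field.
have [|c /[!in_itv]/= /andP[c0 _]] :=
    @MVT_segment R _ _ 0 x x0 (fun y _ => df y).
  apply: derivable_within_continuous => y _.
  exact: (@ex_derive _ _ _ _ _ _ _ (df y)).
rewrite expR0 !subr0 add0r expr0n /= mul0r subr0 => e.
have : 0 <= (expR c - (1 + c)) * x by rewrite mulr_ge0 // subr_ge0 expR_ge1Dx.
rewrite -e; lra.
Qed.

(** With [t = ln (1 / delta) / m] and [x = 2 sqrt t], the reciprocal of [zeta1] is
    [b = 1 + x + x^2 / 2 <= exp x]. Hence [1 - b + ln b <= - x^2 / 2 = - 2 t], and half of [m] times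
    this is [ln delta]. *)
Lemma zeta1V (m : nat) (delta : R) : (0 < m)%N -> 0 < delta < 1 ->
  let b := (zeta1 m delta)^-1 in
  1 <= b /\ expR (m%:R / 2 * (1 - b + ln b)) <= delta.
Proof.
move=> m0 /andP[dl0 dl1] b.
have m0' : 0 < m%:R :> R by rewrite ltr0n.
set t := ln delta^-1 / m%:R.
have t0 : 0 <= t by rewrite divr_ge0 ?(ltW m0') // ln_ge0 // invf_ge1 // ltW.
set x := 2 * Num.sqrt t.
have x0 : 0 <= x by rewrite mulr_ge0 ?sqrtr_ge0.
have x2 : x ^+ 2 = 4 * t by rewrite exprMn sqr_sqrtr //; ring.
have bE : b = 1 + x + x ^+ 2 / 2.
  by rewrite /b /zeta1 invrK x2 /x -mulrA -/t; field.
have b1 : 1 <= b by rewrite bE; nra.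
split => //; have lb : ln b <= x.
  rewrite -ler_expR lnK ?posrE; last exact: lt_le_trans b1.
  by rewrite bE; exact: expR_ge_quadratic.
rewrite -[leRHS]lnK ?posrE // ler_expR.
have -> : ln delta = - (m%:R * t).
  by rewrite /t mulrC divfK ?gt_eqF // lnV ?posrE // opprK.
have : m%:R * (1 - b + ln b) <= m%:R * (- (2 * t)).
  have b2 : b = 1 + x + 2 * t by rewrite bE x2; field.
  by rewrite ler_wpM2l ?(ltW m0') //; lra.
lra.
Qed.

(** The function [exp y (1 - y) + y^2 / 2] equals 1 at 0 and has derivative [y - y exp y <= 0]. *)
Lemma expR_onem_le (s : R) : 0 <= s -> s < 1 ->
  expR s * (1 - s) <= 1 - s ^+ 2 / 2.
Proof.
move=> s0 s1.
have df (x : R) : is_derive x 1 (fun y : R => expR y * (1 - y) + y ^+ 2 / 2)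
    (x - x * expR x).
  apply: is_derive_eq.
  by rewrite /GRing.scale /= ?expr1 -mulr_natr; field.
have [|c /[!in_itv]/= /andP[c0 _]] :=
    @MVT_segment R _ _ 0 s s0 (fun x _ => df x).
  apply: derivable_within_continuous => x _.
  exact: (@ex_derive _ _ _ _ _ _ _ (df x)).
rewrite expR0 !subr0 mulr1 expr0n /= mul0r addr0 => e.
have : (c - c * expR c) * s <= 0.
  rewrite mulr_le0_ge0 // subr_le0 ler_peMr //.
  by rewrite -expR0 ler_expR.
rewrite -e; lra.
Qed.

(** With [A = delta^(2 / m)], the goal reduces to [1 - c + ln c <= ln A]. For [c = A / e] the left
    side is [ln A - c]; for [c = 1 - s] with [s^2 = 2 (1 - A)] it follows from
    [exp s (1 - s) <= 1 - s^2 / 2 = A]. *)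
Lemma zeta2V (m : nat) (delta : R) : (0 < m)%N -> 0 < delta < 1 ->
  let b := (zeta2 m delta)^-1 in
  0 < b <= 1 /\ expR (m%:R / 2 * (1 - b + ln b)) <= delta.
Proof.
move=> m0 /andP[dl0 dl1] b.
have m0' : 0 < m%:R :> R by rewrite ltr0n.
set A := delta `^ (2 / m%:R).
have A0 : 0 < A by rewrite powR_gt0.
have A1 : A <= 1.
  rewrite -[leRHS](powRr0 delta); apply: ger_powR; first by rewrite dl0 ltW.
  by rewrite divr_ge0 ?ltW.
have lnA : m%:R / 2 * ln A = ln delta by rewrite ln_powR; field; lra.
have key c : 0 < c -> 1 - c + ln c <= ln A ->
    expR (m%:R / 2 * (1 - c + ln c)) <= delta.
  move=> c0 h; rewrite -[leRHS]lnK ?posrE // ler_expR -lnA.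
  by rewrite ler_wpM2l // divr_ge0 ?ltW.
have e1 : 1 <= expR 1 :> R by rewrite -expR0 ler_expR.
rewrite /b /zeta2 invrK -/A.
set s := Num.sqrt _; have s0 : 0 <= s by exact: sqrtr_ge0.
have s2 : s ^+ 2 = 2 * (1 - A) by rewrite sqr_sqrtr // mulr_ge0 // subr_ge0.
set c1 := _^-1 * A.
have c10 : 0 < c1 by rewrite mulr_gt0 ?invr_gt0 ?expR_gt0.
have c11 : c1 <= 1.
  by rewrite mulr_ile1 ?invr_ge0 ?expR_ge0 ?(ltW A0) // invf_le1 ?expR_gt0.
have [c12|c12] := leP c1 (1 - s).
  (* The second candidate may be negative in general; being the larger of the two makes it
     positive. *)
  have c20 : 0 < 1 - s by exact: lt_le_trans c12.
  split; first by rewrite c20 /= lerBlDr lerDl.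
  apply: key => //; rewrite -ler_expR lnK ?posrE // expRD lnK ?posrE //.
  have := @expR_onem_le s s0; rewrite s2 => /(_ ltac:(lra)).
  by rewrite (_ : 1 - (1 - s) = s); [lra | ring].
split; first by rewrite c10.
apply: key => //; rewrite lnM ?posrE ?invr_gt0 ?expR_gt0 // lnV ?posrE ?expR_gt0 //.
by rewrite expRK; lra.
Qed.

End ChernoffExponents.

(** * Measurability of sets defined by comparisons *)

Section MeasurableComparison.
Variables (R : realType) (d0 : measure_display) (T : measurableType d0).
Variables f g : T -> R.
Hypotheses (mf : measurable_fun setT f) (mg : measurable_fun setT g).

Lemma measurable_set_le : measurable [set t | f t <= g t].
Proof.
have := measurable_fun_ler mf mg measurableT (Y := [set true]) Logic.I.
by rewrite setTI; congr (measurable _); apply/seteqP; split => t /=.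
Qed.

Lemma measurable_set_lt : measurable [set t | f t < g t].
Proof.
have := measurable_fun_ltr mf mg measurableT (Y := [set true]) Logic.I.
by rewrite setTI; congr (measurable _); apply/seteqP; split => t /=.
Qed.

Lemma measurable_set_eq : measurable [set t | f t = g t].
Proof.
have := measurable_fun_eqr mf mg measurableT (Y := [set true]) Logic.I.
by rewrite setTI; congr (measurable _); apply/seteqP; split => t /= /eqP.
Qed.

End MeasurableComparison.

(** * Expectation of bounded random variables *)

Section BoundedMeasurable.
Variables (R : realType) (d0 : measure_display) (Omega : measurableType d0).
Variable (P : probability Omega R).
Implicit Types f g : Omega -> R.

(** The bound holds at every outcome, so the class is stable under sums and products and all its
    members are integrable. *)
Definition bounded_measurable f :=
  measurable_fun setT f /\ exists M, forall w, `|f w| <= M.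
Local Notation bm := bounded_measurable.

Definition Ex f : R := \int[P]_w f w.

Lemma bm_cst c : bm (fun=> c).
Proof. by split; [exact: measurable_cst|exists `|c|]. Qed.

Lemma bmD f g : bm f -> bm g -> bm (fun w => f w + g w).
Proof.
move=> [mf [M fM]] [mg [N gN]]; split; first exact: measurable_funD.
by exists (M + N) => w; rewrite (le_trans (ler_normD _ _)) // lerD.
Qed.

Lemma bmM f g : bm f -> bm g -> bm (fun w => f w * g w).
Proof.
move=> [mf [M fM]] [mg [N gN]]; split; first exact: measurable_funM.
by exists (M * N) => w; rewrite normrM ler_pM.
Qed.

Lemma bmN f : bm f -> bm (fun w => - f w).
Proof.
move=> [mf [M fM]]; split; first exact: measurable_funN.
by exists M => w; rewrite normrN.
Qed.

Lemma bmB f g : bm f -> bm g -> bm (fun w => f w - g w).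
Proof. by move=> bf bg; apply: bmD => //; exact: bmN. Qed.

Lemma bmX f n : bm f -> bm (fun w => f w ^+ n).
Proof.
move=> bf; elim: n => [|n IH]; first exact: bm_cst.
under [X in bm X]eq_fun do rewrite exprS.
exact: bmM.
Qed.

Lemma bm_sum (I : Type) (s : seq I) (Q : pred I) (F : I -> Omega -> R) :
  (forall i, Q i -> bm (F i)) -> bm (fun w => \sum_(i <- s | Q i) F i w).
Proof.
move=> bF; elim: s => [|i s IH].
  by under [X in bm X]eq_fun do rewrite big_nil; exact: bm_cst.
case Qi: (Q i); under [X in bm X]eq_fun do rewrite big_cons Qi; last by [].
by apply: bmD => //; exact: bF.
Qed.

Lemma bm_integrable f : bm f -> P.-integrable setT (EFin \o f).
Proof.
move=> [mf [M fM]]; apply: measurable_bounded_integrable => //.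
  exact: le_lt_trans (probability_le1 P measurableT) (ltry 1).
by exists M; split; [exact: num_real | move=> x Mx w _; exact: le_trans (fM w) (ltW Mx)].
Qed.

Lemma Ex_cst c : Ex (fun=> c) = c.
Proof.
rewrite /Ex Rintegral_cst // [fine _](_ : _ = 1) ?mulr1 //.
exact: (congr1 fine (probability_setT P)).
Qed.

Lemma ExD f g : bm f -> bm g -> Ex (fun w => f w + g w) = Ex f + Ex g.
Proof. by move=> bf bg; rewrite /Ex RintegralD //; exact: bm_integrable. Qed.

Lemma ExZ c f : bm f -> Ex (fun w => c * f w) = c * Ex f.
Proof. by move=> bf; rewrite /Ex RintegralZl //; exact: bm_integrable. Qed.

Lemma Ex_sum (I : Type) (s : seq I) (Q : pred I) (F : I -> Omega -> R) :
  (forall i, Q i -> bm (F i)) ->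
  Ex (fun w => \sum_(i <- s | Q i) F i w) = \sum_(i <- s | Q i) Ex (F i).
Proof.
move=> bF; elim: s => [|i s IH].
  by under [X in Ex X]eq_fun do rewrite big_nil; rewrite big_nil Ex_cst.
rewrite big_cons.
case Qi: (Q i); under [X in Ex X]eq_fun do rewrite big_cons Qi; last by [].
by rewrite ExD ?IH //; [exact: bF | exact: bm_sum].
Qed.

Lemma Ex_le f g : bm f -> bm g -> (forall w, f w <= g w) -> Ex f <= Ex g.
Proof. by move=> bf bg fg; apply: le_Rintegral => //; exact: bm_integrable. Qed.

Lemma Ex_ge0 f : (forall w, 0 <= f w) -> 0 <= Ex f.
Proof. by move=> f0; apply: Rintegral_ge0. Qed.

Lemma Ex_ae f g : bm f -> bm g -> {ae P, forall w, f w = g w} -> Ex f = Ex g.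
Proof.
move=> [mf _] [mg _] fg; congr fine; apply: ae_eq_integral => //.
- exact/measurable_EFinP.
- exact/measurable_EFinP.
- by apply: filterS fg => w /= -> .
Qed.

Lemma Ex_indic (A : set Omega) : measurable A -> (Ex \1_A)%:E = P A.
Proof.
move=> mA; rewrite /Ex /Rintegral integral_indic // setIT fineK //.
exact: fin_num_measure.
Qed.

Lemma bm_indic (A : set Omega) : measurable A -> bm \1_A.
Proof.
move=> mA; split; first exact: measurable_indic.
by exists 1 => w; rewrite indicE; case: (_ \in _); rewrite ?normr0 ?normr1.
Qed.

End BoundedMeasurable.
Local Notation bm := bounded_measurable.

(** * Low-order coefficients of powers of polynomials *)

Section PolyCoef2.
Variable R : comNzRingType.
Implicit Types p : {poly R}.

Lemma coef0_exp p n : (p ^+ n)`_0 = p`_0 ^+ n.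
Proof. by elim: n => [|n IH]; rewrite ?expr0 ?coef1 // !exprS coef0M IH. Qed.

Lemma coef1_exp p n : (p ^+ n.+1)`_1 = n.+1%:R * p`_0 ^+ n * p`_1.
Proof.
elim: n => [|n IH]; first by rewrite expr1 expr0 !mul1r.
rewrite exprS coefM !big_ord_recr big_ord0 /= add0r IH coef0_exp.
rewrite -[in RHS](natr1 n.+1) !exprS; ring.
Qed.

Lemma coef2_exp p n : (p ^+ n.+1)`_2 *+ 2 =
  n.+1%:R * (p`_0 ^+ n * p`_2 *+ 2 + n%:R * p`_0 ^+ n.-1 * p`_1 ^+ 2).
Proof.
elim: n => [|n IH]; first by rewrite expr1 expr0 !mul1r !mul0r addr0.
rewrite exprS coefM !big_ord_recr big_ord0 /= add0r !mulrnDl -[p`_0 * _ *+ 2]mulrnAr IH.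
rewrite coef1_exp coef0_exp !mulr2n.
case: n {IH} => [|n] /=; first by rewrite !expr0 !expr1; ring.
rewrite -[in RHS](natr1 n.+2) -!(natr1 n.+1) -!(natr1 n) !exprS; ring.
Qed.

Lemma coef2_1Xsq n : ((1 + 'X^2) ^+ n : {poly R})`_2 = n%:R.
Proof.
elim: n => [|n IH]; first by rewrite expr0 coef1.
rewrite exprS coefM !big_ord_recr big_ord0 /= IH !coefD !coef1 !coefXn /=.
by rewrite !coef0_exp !coefD !coef1 !coefXn /= !addr0 !expr1n -natr1; ring.
Qed.

End PolyCoef2.

Lemma horner_inj (R : realType) (p q : {poly R}) :
  (forall t, p.[t] = q.[t]) -> p = q.
Proof.
move=> pq; apply/eqP; rewrite -subr_eq0; apply/eqP.
apply: (@roots_geq_poly_eq0 _ _ [seq i%:R | i <- iota 0 (size (p - q))]).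
- by apply/allP => x /mapP[i _ ->]; rewrite /root hornerD hornerN pq subrr.
- rewrite map_inj_uniq ?iota_uniq // => i j /eqP.
  by rewrite eqr_nat => /eqP.
- by rewrite size_map size_iota.
Qed.

(** * Expected coefficients of a random polynomial *)

Section RandomPoly.
Variables (R : realType) (d0 : measure_display) (Omega : measurableType d0).
Variable (P : probability Omega R) (p : Omega -> {poly R}) (N : nat).
Hypothesis p_bm : forall j, bm (fun w => (p w)`_j).
Hypothesis p_size : forall w, (size (p w) <= N)%N.

Lemma bm_coef_exp n j : bm (fun w => (p w ^+ n)`_j).
Proof.
elim: n j => [|n IH] j.
  by under [X in bm X]eq_fun do rewrite expr0 coef1; exact: bm_cst.
under [X in bm X]eq_fun do rewrite exprS coefM.
by apply: bm_sum => i _; apply: bmM.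
Qed.

(** Both sides of the hypothesis are polynomials in [t] that agree at every real point, so their
    coefficients agree. This replaces differentiation under the expectation. *)
Lemma Ex_coef2_exp n (c : R) (k : nat) :
  (forall t, Ex P (fun w => (p w).[t] ^+ n) = c * (1 + t ^+ 2) ^+ k) ->
  Ex P (fun w => (p w ^+ n)`_2) = c * k%:R.
Proof.
(* [M] exceeds the degree of the power and is at least 3, so that the coefficient of index 2 is
   kept. *)
move=> h; pose M := (N * n).+3.
have szp w : (size (p w ^+ n)%R <= M)%N.
  apply: leq_trans (size_poly_exp_leq _ _) _; rewrite /M ltnS.
  apply: (@leq_trans (N * n)); last by rewrite -addn2 leq_addr.
  by rewrite leq_mul2r (leq_trans (leq_pred _) (p_size w)) orbT.
have e : \poly_(j < M) Ex P (fun w => (p w ^+ n)`_j) = c *: (1 + 'X^2) ^+ k.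
  apply: horner_inj => t; rewrite hornerZ horner_exp !hornerE -h horner_poly.
  under [in RHS]eq_fun do rewrite -horner_exp (horner_coef_wide t (szp _)).
  rewrite Ex_sum => [|j _]; last first.
    by apply: bmM; [exact: bm_coef_exp | exact: bm_cst].
  apply: eq_bigr => j _; rewrite mulrC -ExZ; last exact: bm_coef_exp.
  by congr Ex; apply/funext => w; rewrite mulrC.
have := congr1 (fun q : {poly R} => q`_2) e.
by rewrite coef_poly coefZ coef2_1Xsq.
Qed.

End RandomPoly.

(** * The moment recursion deduced from rotation invariance *)

Section MomentRecursion.
Variables (R : realType) (d0 : measure_display) (Omega : measurableType d0).
Variable (P : probability Omega R) (d : nat).
Variables (u : Omega -> 'rV[R]_d) (Pi : Omega -> 'M[R]_d).
Hypothesis u_meas : forall j, measurable_fun setT (fun w => u w ord0 j).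
Hypothesis Pi_meas : forall i j, measurable_fun setT (fun w => Pi w i j).
Hypothesis u_le1 : forall w, bform 1%:M (u w) (u w) <= 1.
Hypothesis Pi_proj : forall w, orth_proj (Pi w).
Hypothesis rot_inv : forall (Q : 'M[R]_d) n, Q *m Q^T = 1%:M ->
  Ex P (fun w => bform (Pi w) (u w *m Q) (u w *m Q) ^+ n) =
  Ex P (fun w => bform (Pi w) (u w) (u w) ^+ n).

Let q w := bform (Pi w) (u w) (u w).
Let N w := bform 1%:M (u w) (u w).
Let bu j : bm (fun w => u w ord0 j).
Proof. by split => //; exists 1 => w; exact: bform1_le1_coord. Qed.

Let bPi i j : bm (fun w => Pi w i j).
Proof. by split => //; exists 1 => w; exact: orth_proj_entry. Qed.

Let bw j : bm (fun w => (u w *m Pi w) ord0 j).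
Proof.
under [X in bm X]eq_fun do rewrite mxE.
by apply: bm_sum => i _; exact: bmM.
Qed.

Lemma bm_energy : bm q.
Proof.
rewrite /q; under [X in bm X]eq_fun do rewrite bformEmx bform1E.
by apply: bm_sum => i _; exact: bmM.
Qed.

Lemma bm_sqnorm : bm N.
Proof.
rewrite /N; under [X in bm X]eq_fun do rewrite bform1E.
by apply: bm_sum => i _; exact: bmM.
Qed.

Lemma bm_trace : bm (fun w => \tr (Pi w)).
Proof. by rewrite /mxtrace; apply: bm_sum. Qed.

(* The t^2-coefficient of the identity E[q(u Q_t)^(n+1)] = E[q(u)^(n+1)],
   Q_t the rotation of the (a, b)-plane. *)
Let plane_identity (a b : 'I_d) n : b != a ->
  Ex P (fun w =>
    q w ^+ n * ((u w ord0 a ^+ 2 * Pi w b b + u w ord0 b ^+ 2 * Pi w a a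
                 - 2 * u w ord0 a * u w ord0 b * Pi w a b)
                - (u w ord0 a * (u w *m Pi w) ord0 a
                   + u w ord0 b * (u w *m Pi w) ord0 b))
    + 2 * n%:R * (q w ^+ n.-1 *
        (u w ord0 a * (u w *m Pi w) ord0 b
         - u w ord0 b * (u w *m Pi w) ord0 a) ^+ 2)) = 0.
Proof.
move=> ab.
pose ua w := u w ord0 a; pose ub w := u w ord0 b.
pose wa w := (u w *m Pi w) ord0 a; pose wb w := (u w *m Pi w) ord0 b.
pose Bua w := ua w * wb w - ub w * wa w.
pose Bup w := ua w * wa w + ub w * wb w.
pose Baa w := ua w ^+ 2 * Pi w b b + ub w ^+ 2 * Pi w a a
  - 2 * ua w * ub w * Pi w a b.
pose Bpp w := ua w ^+ 2 * Pi w a a + ub w ^+ 2 * Pi w b b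
  + 2 * ua w * ub w * Pi w a b.
pose Bap w := (ua w ^+ 2 - ub w ^+ 2) * Pi w a b
  + ua w * ub w * (Pi w b b - Pi w a a).
pose s w := [:: q w; 4 * Bua w; 2 * q w + 4 * Baa w - 4 * Bup w;
                4 * Bua w - 8 * Bap w; q w + 4 * Bpp w - 4 * Bup w].
pose p w : {poly R} := Poly (s w).
have bc c := @bm_cst R d0 Omega c; have bq := bm_energy.
have bua : bm ua := bu a; have bub : bm ub := bu b.
have bwa : bm wa := bw a; have bwb : bm wb := bw b.
have bBua : bm Bua by apply: bmB; apply: bmM.
have bBup : bm Bup by apply: bmD; apply: bmM.
have bBaa : bm Baa.
  by apply: bmB; [apply: bmD|]; repeat (apply: bmM || apply: bmX || apply: bmD).
have bBpp : bm Bpp.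
  by apply: bmD; [apply: bmD|]; repeat (apply: bmM || apply: bmX || apply: bmD).
have bBap : bm Bap.
  apply: bmD; apply: bmM => //; [|exact: bmM|exact: bmB].
  by apply: bmB; apply: bmX.
have p_bm j : bm (fun w => (p w)`_j).
  under [X in bm X]eq_fun do rewrite coef_Poly.
  case: j => [|[|[|[|[|j]]]]] /=; rewrite ?nth_nil //.
  - exact: bmM.
  - by apply: bmB; [apply: bmD; apply: bmM | apply: bmM].
  - by apply: bmB; apply: bmM.
  - by apply: bmB; [apply: bmD => //; apply: bmM | apply: bmM].
have p_size w : (size (p w) <= 5)%N by exact: size_Poly.
have p_val t w : (p w).[t] =
    bform (Pi w) (u w *m plane_rot a b t) (u w *m plane_rot a b t)
    * (1 + t ^+ 2) ^+ 2.
  have /= -> := @bform_plane_rot R d a b (Pi w) (u w) t (proj1 (Pi_proj w)).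
  rewrite horner_Poly /=.
  by rewrite /Bua /Bup /Baa /Bpp /Bap /ua /ub /wa /wb -/(q w); ring.
have E t : Ex P (fun w => (p w).[t] ^+ n.+1) =
    Ex P (fun w => q w ^+ n.+1) * (1 + t ^+ 2) ^+ (2 * n.+1).
  rewrite -(rot_inv n.+1 (plane_rot_orth ab t)) mulrC -ExZ.
    by congr Ex; apply/funext => w; rewrite p_val exprMn -exprM mulrC.
  pose p' w := (p w).[t] * ((1 + t ^+ 2) ^+ 2)^-1.
  rewrite (_ : (fun w => _) = (fun w => p' w ^+ n.+1)).
    apply: bmX; apply: bmM => //.
    under [X in bm X]eq_fun do rewrite (horner_coef_wide t (p_size _)).
    by apply: bm_sum => i _; apply: bmM.
  apply/funext => w; rewrite /p' p_val mulfK // expf_neq0 //.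
  by rewrite gt_eqF // ltr_pwDl // sqr_ge0.
have := Ex_coef2_exp p_bm p_size E.
move=> /(congr1 (fun x => 2 * x)); rewrite -ExZ; last exact: bm_coef_exp.
(* The last term comes from the summand [2 * q w] of the coefficient of [t^2]; it cancels the
   coefficient of [t^2] in [(1 + t^2)^(2 (n + 1))]. *)
have -> : (fun w => 2 * (p w ^+ n.+1)`_2) = (fun w =>
   8 * n.+1%:R * (q w ^+ n * (Baa w - Bup w)
     + 2 * n%:R * (q w ^+ n.-1 * Bua w ^+ 2)) + 4 * n.+1%:R * q w ^+ n.+1).
  apply/funext => w; rewrite mulr_natl coef2_exp !coef_Poly /= [q w ^+ n.+1]exprS mulr2n.
  by ring.
have bI : bm (fun w => q w ^+ n * (Baa w - Bup w)
     + 2 * n%:R * (q w ^+ n.-1 * Bua w ^+ 2)).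
  apply: bmD; first by apply: bmM; [exact: bmX | exact: bmB].
  by apply: bmM => //; apply: bmM; apply: bmX.
rewrite ExD ?ExZ //; [|exact: bmX|by apply: bmM|by apply: bmM => //; exact: bmX].
rewrite natrM => h.
have {}h : (8 * n.+1%:R) * Ex P (fun w => q w ^+ n * (Baa w - Bup w)
     + 2 * n%:R * (q w ^+ n.-1 * Bua w ^+ 2)) = 0.
  by move: h; set x := Ex _ _; set y := Ex _ _; lra.
by move/eqP: h; rewrite mulf_eq0 mulf_eq0 !pnatr_eq0 => /eqP.
Qed.

(** Summing [plane_identity] over all planes and inserting [sum_planes] gives the result. Only
    moments are assumed invariant, with [Pi] unchanged, so this serves both a random vector
    independent of its projector and a fixed vector facing a rotation-invariant projector. *)
Lemma moment_recursion n :
  (d%:R + 2 * n%:R) * Ex P (fun w => q w ^+ n.+1) =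
  Ex P (fun w => (\tr (Pi w) + 2 * n%:R) * N w * q w ^+ n).
Proof.
have bc c := @bm_cst R d0 Omega c; have bq := bm_energy.
have bN := bm_sqnorm; have bt := bm_trace.
pose F a b w := q w ^+ n * ((u w ord0 a ^+ 2 * Pi w b b
    + u w ord0 b ^+ 2 * Pi w a a - 2 * u w ord0 a * u w ord0 b * Pi w a b)
    - (u w ord0 a * (u w *m Pi w) ord0 a
       + u w ord0 b * (u w *m Pi w) ord0 b))
    + 2 * n%:R * (q w ^+ n.-1 *
        (u w ord0 a * (u w *m Pi w) ord0 b
         - u w ord0 b * (u w *m Pi w) ord0 a) ^+ 2).
have bF a b : bm (F a b).
  apply: bmD; apply: bmM => //; first exact: bmX; last first.
    apply: bmM; apply: bmX => //.
    by apply: bmB; apply: bmM.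
  apply: bmB; last by apply: bmD; apply: bmM.
  by apply: bmB; [apply: bmD|]; repeat (apply: bmM || apply: bmX || apply: bmD).
have z : Ex P (fun w => \sum_(a < d) \sum_(b < d | b != a) F a b w) = 0.
  rewrite Ex_sum => [|a _]; last by apply: bm_sum => b _.
  by rewrite big1 // => a _; rewrite Ex_sum // big1 // => b; exact: plane_identity.
have e w : \sum_(a < d) \sum_(b < d | b != a) F a b w =
   2 * ((\tr (Pi w) + 2 * n%:R) * N w * q w ^+ n)
     + (- (2 * (d%:R + 2 * n%:R))) * q w ^+ n.+1.
  have [sP pP] := Pi_proj w.
  have [e1 e2 e3] := sum_planes (u w) sP pP.
  rewrite /F; under eq_bigr do rewrite big_split /= -!mulr_sumr sumrB.
  rewrite big_split /= -!mulr_sumr sumrB e1 e2 e3 -/(q w) -/(N w).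
  (* For positive [n], [q^(n-1)] times [q] is [q^n]; for [n = 0] the factor [n] removes the term. *)
  case: (n) => [|k] /=; rewrite ?expr0 !exprS; ring.
have b1 : bm (fun w => (\tr (Pi w) + 2 * n%:R) * N w * q w ^+ n).
  by apply: bmM; [apply: bmM => //; exact: bmD | exact: bmX].
move: z; rewrite (funext e).
rewrite ExD ?ExZ //; [|exact: bmX|by apply: bmM|by apply: bmM => //; exact: bmX].
set x := Ex _ _; set y := Ex _ _; lra.
Qed.

End MomentRecursion.

(** * Tail bound for a variable with Beta moments *)

Section BetaTail.
Variables (R : realType) (d0 : measure_display) (Omega : measurableType d0).
Variable (P : probability Omega R) (X : Omega -> R) (n p : R).
Hypothesis bX : bm X.
Hypothesis X01 : forall w, 0 <= X w <= 1.
Hypothesis n_ge1 : 1 <= n.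
Hypothesis p_ge0 : 0 <= p.
Hypothesis beta_moments : forall k,
  (n + k%:R) * Ex P (fun w => X w ^+ k.+1) = (p + k%:R) * Ex P (fun w => X w ^+ k).

(** The moments of a Beta(p, n - p) law are the quotients [bcoef p k / bcoef n k]. *)
Lemma bcoef_moment k : bcoef n k * Ex P (fun w => X w ^+ k) = bcoef p k.
Proof.
elim: k => [|k IH]; first by rewrite /bcoef !big_ord0 mul1r Ex_cst.
apply: (mulIf (x := k.+1%:R)); first by rewrite pnatr_eq0.
by rewrite mulrAC bcoefS -mulrA beta_moments bcoefS mulrCA -IH; ring.
Qed.

(** Markov's inequality for the truncated series of [(1 - s X)^(-n)]: its expectation is a partial
    sum of [(1 - s)^(-p)], and on the event it is at least the partial sum at [s * c]. Passing to
    the limit only in the final inequality avoids exchanging series and expectation. *)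
Lemma beta_tail (c s : R) : 0 <= c <= 1 -> 0 <= s < 1 ->
  (P [set w | (c <= X w)%R] <= (((1 - s) `^ p)^-1 * (1 - s * c) `^ n)%:E)%E.
Proof.
move=> /andP[c0 c1] /andP[s0 s1].
have mA : measurable [set w | c <= X w].
  by apply: measurable_set_le; [exact: measurable_cst | exact: (proj1 bX)].
rewrite -Ex_indic // lee_fin.
have sc1 : s * c < 1 by apply: le_lt_trans s1; rewrite ler_piMr.
apply: bsum_limit_le => //; first by rewrite mulr_ge0.
  by apply: Ex_ge0 => w; rewrite indicE.
move=> N; rewrite mulrC -ExZ; last exact: bm_indic.
have bY k : bm (fun w => s ^+ k * bcoef n k * X w ^+ k).
  by apply: bmM; [exact: bm_cst | exact: bmX].
apply: (@le_trans _ _ (Ex P (fun w => \sum_(k < N) s ^+ k * bcoef n k * X w ^+ k))).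
  apply: Ex_le.
  - by apply: bmM; [exact: bm_cst | exact: bm_indic].
  - by apply: bm_sum => k _; exact: bY.
  move=> w; have [X0 X1] := andP (X01 w); rewrite indicE.
  have n0 : 0 <= n by exact: le_trans n_ge1.
  case: (boolP (w \in _)) => [|_]; last first.
    rewrite mulr0 sumr_ge0 // => k _.
    by rewrite !mulr_ge0 ?exprn_ge0 ?bcoef_ge0.
  rewrite inE /= => cX; rewrite mulr1 bsumE ler_sum // => k _.
  rewrite exprMn mulrCA mulrA ler_wpM2l ?mulr_ge0 ?exprn_ge0 ?bcoef_ge0 //.
  by rewrite lerXn2r ?nnegrE.
rewrite Ex_sum // (eq_bigr (fun k : 'I_N => bcoef p k * s ^+ k)).
  rewrite -bsumE -[leRHS]mul1r ler_pdivlMr ?powR_gt0 ?subr_gt0 //.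
  exact: bsum_ub.
by move=> k _; rewrite ExZ; [rewrite -mulrA bcoef_moment mulrC | exact: bmX].
Qed.

End BetaTail.

(** * Borel measurability on row vectors *)

Section BorelSpace.
Variables (R : realType) (d : nat).

(** Its measurable sets are convertible to [borelRd], so the assumptions on random vectors read
    directly as measurability. *)
Definition borel_rV := g_sigma_algebraType [set A : set 'rV[R]_d | open A].

Lemma mulmxr_continuous (Q : 'M[R]_d) : continuous (fun x : 'rV[R]_d => x *m Q).
Proof.
move=> x A [B nB BA].
have c i j : continuous (fun x : 'rV[R]_d => (x *m Q) i j).
  under [X in continuous X]eq_fun do rewrite mxE.
  apply: continuous_big => [|k _]; first exact: add_continuous.
  move=> y; apply: (@continuousM R _ (fun x : 'rV[R]_d => x i k) (fun=> Q k j)).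
    exact: coord_continuous.
  exact: cst_continuous.
have h i j : nbhs x [set y | B i j ((y *m Q) i j)] by exact: (c i j x _ (nB i j)).
have hB := filter_forall (nbhs_filter x) (fun i => filter_forall (nbhs_filter x) (h i)).
change (nbhs x [set y | A (y *m Q)]).
by apply: (@filterS _ _ (nbhs_filter x) _ _ _ hB) => y By; apply: BA => i j; exact: By.
Qed.

Lemma measurable_mulmxr (Q : 'M[R]_d) :
  @measurable_fun _ _ borel_rV borel_rV setT (fun x => x *m Q).
Proof.
apply: (@measurability _ _ borel_rV borel_rV setT _
  [set A : set 'rV[R]_d | open A]) => //.
move=> _ [B oB <-]; rewrite setTI; apply: sub_sigma_algebra.
by have /continuousP := @mulmxr_continuous Q; exact.
Qed.

Lemma measurable_coord j :
  measurable_fun setT (fun x : borel_rV => (x : 'rV[R]_d) ord0 j).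
Proof.
apply: (measurability _ (RGenOInfty.measurableE R)) => //.
move=> _ [_ [a ->] <-]; rewrite setTI; apply: sub_sigma_algebra => /=.
have /continuousP := @coord_continuous R 1 d ord0 j; apply.
exact: interval_open.
Qed.

End BorelSpace.

(** The convention [0^-1 = 0] agrees with the real power of exponent -1, which is measurable on the
    whole line. *)
Lemma measurable_ge0_inv (R : realType) (d0 : measure_display)
    (T : measurableType d0) (f : T -> R) :
  (forall x, 0 <= f x) -> measurable_fun setT f ->
  measurable_fun setT (fun x => (f x)^-1).
Proof.
move=> f0 mf; rewrite (_ : (fun x => _) = (fun x => f x `^ (-1))).
  exact: (measurableT_comp (measurable_powR (-1))).
by apply/funext => x; rewrite powR_inv1.
Qed.

Lemma measurable_ge0_sqrt (R : realType) (d0 : measure_display)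
    (T : measurableType d0) (f : T -> R) :
  (forall x, 0 <= f x) -> measurable_fun setT f ->
  measurable_fun setT (fun x => Num.sqrt (f x)).
Proof.
move=> f0 mf; rewrite (_ : (fun x => _) = (fun x => f x `^ 2^-1)).
  exact: (measurableT_comp (measurable_powR 2^-1)).
by apply/funext => x; rewrite powR12_sqrt.
Qed.

(** * Measurability of random matrices and of the Gram-Schmidt projector *)

Section MeasurableMatrices.
Variables (R : realType) (d0 : measure_display) (T : measurableType d0) (d : nat).

Definition measurable_mx (k l : nat) (A : T -> 'M[R]_(k, l)) :=
  forall i j, measurable_fun setT (fun x => A x i j).

Lemma measurable_sumr (I : Type) (s : seq I) (F : I -> T -> R) :
  (forall i, measurable_fun setT (F i)) ->
  measurable_fun setT (fun x => \sum_(i <- s) F i x).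
Proof.
move=> mF; elim: s => [|i s IH].
  by under [X in measurable_fun _ X]eq_fun do rewrite big_nil; exact: measurable_cst.
under [X in measurable_fun _ X]eq_fun do rewrite big_cons.
exact: measurable_funD.
Qed.

Lemma measurable_mulmx k l n (A : T -> 'M[R]_(k, l)) (B : T -> 'M[R]_(l, n)) :
  measurable_mx A -> measurable_mx B -> measurable_mx (fun x => A x *m B x).
Proof.
move=> mA mB i j; under [X in measurable_fun _ X]eq_fun do rewrite mxE.
by apply: measurable_sumr => r; exact: measurable_funM.
Qed.

Lemma measurable_bform (P : T -> 'M[R]_d) (u w : T -> 'rV[R]_d) :
  measurable_mx P -> measurable_mx u -> measurable_mx w ->
  measurable_fun setT (fun x => bform (P x) (u x) (w x)).
Proof.
move=> mP mu mw; rewrite /bform; apply: measurable_mulmx => [|i j].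
  exact: measurable_mulmx.
by under [X in measurable_fun _ X]eq_fun do rewrite mxE; exact: mw.
Qed.

Lemma measurable_cst_mx k l (A : 'M[R]_(k, l)) : measurable_mx (fun=> A).
Proof. by move=> i j; exact: measurable_cst. Qed.

Lemma measurable_gsproj (x : T -> nat -> 'rV[R]_d) n :
  (forall i, measurable_mx (fun t => x t i)) ->
  measurable_mx (fun t => gsproj (x t) n).
Proof.
move=> mx; elim: n => [|n IH] /=; first exact: measurable_cst_mx.
have mr : measurable_mx (fun t => x t n *m (1%:M - gsproj (x t) n)).
  apply: measurable_mulmx => // i j.
  under [X in measurable_fun _ X]eq_fun do rewrite !mxE.
  by apply: measurable_funB => //; exact: measurable_cst.
move=> i j; under [X in measurable_fun _ X]eq_fun do rewrite !mxE big_ord1 !mxE.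
apply: measurable_funD => //; apply: measurable_funM.
  apply: measurable_ge0_inv => [t|]; first exact: bform1_ge0.
  by apply: measurable_bform => //; exact: measurable_cst_mx.
by apply: measurable_funM; have := mr ord0; [move/(_ i)|move/(_ j)];
  under [X in measurable_fun _ X -> _]eq_fun do rewrite mxE.
Qed.

End MeasurableMatrices.

(** * Invariance of the joint law under separate rotations *)

Section JointLaw.
Variables (R : realType) (d m : nat).
Variables (d0 : measure_display) (Omega : measurableType d0).
Variables (P : probability Omega R) (v : 'I_m -> Omega -> 'rV[R]_d).
Hypothesis v_unif : forall i, uniform_on_sphere P (v i).
Hypothesis v_ind : independent_vectors P v.

(** A family closed under intersection that generates the product sigma-algebra, on which
    independence prescribes the joint law. *)
Definition rectangles : set (set ('I_m -> 'rV[R]_d)) :=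
  [set A | exists2 B, (forall i, @borelRd R d (B i)) &
    A = \bigcap_(i in [set: 'I_m]) [set x | B i (x i)]].

Definition tuple_space := g_sigma_algebraType rectangles.

Lemma measurable_tuple (d1 : measure_display) (T : measurableType d1)
    (f : 'I_m -> T -> borel_rV R d) :
  (forall i, measurable_fun setT (f i)) ->
  @measurable_fun _ _ T tuple_space setT (fun t i => f i t).
Proof.
move=> mf; apply: (@measurability _ _ T tuple_space setT _ rectangles) => //.
move=> _ [_ [B bB ->] <-]; rewrite setTI preimage_bigcap.
apply: fin_bigcap_measurable => // i _.
rewrite -[X in measurable X]setTI.
exact: (mf i measurableT (B i) (bB i)).
Qed.

Lemma measurable_proj i :
  @measurable_fun _ _ tuple_space (borel_rV R d) setT (fun x => x i).
Proof.
move=> _ B mB; rewrite setTI; apply: sub_sigma_algebra.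
exists (fun j => if j == i then B else setT).
  by move=> j; case: ifP => _ //; exact: (@measurableT _ (borel_rV R d)).
apply/seteqP; split => [x /= Bx j _|x /= h]; first by case: eqP => // ->.
by have := h i I; rewrite eqxx.
Qed.

Lemma measurable_tuple_coord i :
  measurable_mx (fun x : tuple_space => (x i : 'rV[R]_d)).
Proof.
move=> k j; rewrite (ord1 k).
exact: (measurableT_comp (@measurable_coord R d j) (measurable_proj i)).
Qed.

Let v_meas i : @measurable_fun _ _ Omega (borel_rV R d) setT (v i).
Proof. by move=> _ B mB; rewrite setTI; have [+ _ _] := v_unif i; exact. Qed.

Let joint w : tuple_space := fun i => v i w.

Lemma measurable_joint : measurable_fun setT joint.
Proof. exact: measurable_tuple. Qed.

(** On rectangles both laws are products of marginals, and each marginal is invariant; uniqueness of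
    measures extends the equality to all measurable sets. A separate [Q i] per vector allows
    rotating one vector alone or all of them together. *)
Lemma joint_rot_inv (Q : 'I_m -> 'M[R]_d) (phi : tuple_space -> R) :
  (forall i, Q i *m (Q i)^T = 1%:M) ->
  measurable_fun setT phi -> (forall x, 0 <= phi x) ->
  Ex P (fun w => phi (fun i => v i w *m Q i)) = Ex P (fun w => phi (joint w)).
Proof.
move=> oQ mphi phi0.
pose jointQ w : tuple_space := fun i => v i w *m Q i.
have vQ_meas i : @measurable_fun _ _ Omega (borel_rV R d) setT (fun w => v i w *m Q i).
  exact: (measurableT_comp (@measurable_mulmxr R d (Q i)) (v_meas i)).
have mjQ : measurable_fun setT jointQ by exact: measurable_tuple.
have mj := measurable_joint.
have := @ge0_integral_pushforward _ _ _ _ R joint mj P setT (EFin \o phi)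
  measurableT ltac:(exact/measurable_EFinP) ltac:(by move=> x _; rewrite lee_fin).
have := @ge0_integral_pushforward _ _ _ _ R jointQ mjQ P setT (EFin \o phi)
  measurableT ltac:(exact/measurable_EFinP) ltac:(by move=> x _; rewrite lee_fin).
rewrite !preimage_setT => e1 e2; rewrite /Ex /Rintegral; congr fine.
transitivity (\int[P]_x (EFin \o phi \o jointQ) x)%E; first by [].
rewrite -e1 -[RHS]e2.
have law A : measurable A -> pushforward P jointQ A = pushforward P joint A.
  pose jQ : {mfun Omega >-> tuple_space} :=
    HB.pack jointQ (isMeasurableFun.Build _ _ _ _ _ mjQ).
  pose j : {mfun Omega >-> tuple_space} :=
    HB.pack joint (isMeasurableFun.Build _ _ _ _ _ mj).
  apply: (@measure_unique _ R tuple_space rectangles (fun=> setT) _ _ _ _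
    (pushforward P jQ) (pushforward P j)) => //.
  - move=> _ _ [B bB ->] [C bC ->]; exists (fun i => B i `&` C i).
      move=> i; exact: (@measurableI _ (borel_rV R d) _ _ (bB i) (bC i)).
    by rewrite -bigcapI.
  - move=> _; exists (fun=> setT); last by apply/seteqP; split.
    by move=> i; exact: (@measurableT _ (borel_rV R d)).
  - by rewrite bigcup_const //; exists 0%N.
  - move=> _ [B bB ->].
    transitivity (\prod_(i < m) P (v i @^-1` B i))%E; last exact: esym (v_ind bB).
    (* Absorbing the rotation into the set makes the event a rectangle for the original vectors, to
       which independence applies. *)
    pose B' i := [set x : 'rV[R]_d | B i (x *m Q i)].
    have bB' i : @borelRd R d (B' i).
      have := @measurable_mulmxr R d (Q i) measurableT _ (bB i).
      by rewrite setTI.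
    transitivity (\prod_(i < m) P (v i @^-1` B' i))%E; first exact: (v_ind bB').
    apply: eq_bigr => i _.
    by have [_ _ /(_ _ (oQ i) _ (bB i)) ->] := v_unif i.
  - move=> _.
    exact: le_lt_trans (probability_le1 P measurableT) (ltry 1).
apply: (@eq_measure_integral _ tuple_space R setT
  (pushforward P joint) (pushforward P jointQ)) => A mA _; exact: law.
Qed.

End JointLaw.

(** * A bounded, rotation-equivariant modification of vectors *)

Section Gate.
Variables (R : realType) (d : nat).
Implicit Types x : 'rV[R]_d.

(* [v i] has norm 1 only almost surely; [gate] is a rotation-equivariant
   modification that is bounded everywhere. *)
Definition gate x : 'rV[R]_d := (Num.max 1 (bform 1%:M x x))^-1 *: x.

Lemma bform1_rot x (Q : 'M[R]_d) : Q *m Q^T = 1%:M ->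
  bform 1%:M (x *m Q) (x *m Q) = bform 1%:M x x.
Proof. by move=> QQ; rewrite /bform !mulmx1 trmx_mul mulmxA -(mulmxA x) QQ mulmx1. Qed.

Lemma gate_rot x (Q : 'M[R]_d) : Q *m Q^T = 1%:M -> gate (x *m Q) = gate x *m Q.
Proof. by move=> QQ; rewrite /gate bform1_rot // scalemxAl. Qed.

Lemma gate_unit x : bform 1%:M x x = 1 -> gate x = x.
Proof. by move=> x1; rewrite /gate x1 maxxx invr1 scale1r. Qed.

(** The maximum [M] is at least 1 and at least the squared norm, so the squared norm is at most
    [M <= M^2]. *)
Lemma gate_le1 x : bform 1%:M (gate x) (gate x) <= 1.
Proof.
rewrite /gate bformZl bformZr mulrA -expr2 exprVn; set M := Num.max _ _.
have M1 : 1 <= M by rewrite le_max lexx.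
have M0 : 0 < M by exact: lt_le_trans M1.
rewrite mulrC ler_pdivrMr ?exprn_gt0 // mul1r.
apply: (@le_trans _ _ M); first by rewrite le_max lexx orbT.
by rewrite expr2 ler_peMr // ltW.
Qed.

Lemma measurable_gate (d0 : measure_display) (T : measurableType d0)
    (u : T -> 'rV[R]_d) : measurable_mx u -> measurable_mx (fun t => gate (u t)).
Proof.
move=> mu i j; rewrite /gate; under [X in measurable_fun _ X]eq_fun do rewrite mxE.
apply: measurable_funM => //; apply: measurable_ge0_inv.
  by move=> t; rewrite le_max ler01.
apply: measurable_maxr; first exact: measurable_cst.
by apply: measurable_bform => //; exact: measurable_cst_mx.
Qed.

End Gate.

(** * Dimension of the random span and concentration of the projected energy *)

Section RandomSubspace.
Variables (R : realType) (d m : nat).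
Variables (d0 : measure_display) (Omega : measurableType d0).
Variables (P : probability Omega R) (v : 'I_m.+1 -> Omega -> 'rV[R]_d).
Hypothesis v_unif : forall i, uniform_on_sphere P (v i).
Hypothesis v_ind : independent_vectors P v.
Hypothesis md : (m.+1 < d)%N.

(** The number of vectors is written [m.+1] so that [inord] can index them by [nat], as [gsproj]
    expects. *)
Definition ext_seq (x : 'I_m.+1 -> 'rV[R]_d) (i : nat) : 'rV[R]_d := x (inord i).

Definition span_proj n w : 'M[R]_d := gsproj (ext_seq (fun i => v i w)) n.

Let tupleT := tuple_space R d m.+1.

Lemma measurable_tuple_gsproj n :
  measurable_mx (fun x : tupleT => gsproj (ext_seq x) n).
Proof. by apply: measurable_gsproj => i; exact: measurable_tuple_coord. Qed.

Lemma measurable_vec i : measurable_mx (v i).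
Proof.
move=> k j; have mj := @measurable_tuple_coord R d m.+1 i k j.
exact: (measurableT_comp mj (measurable_joint v_unif)).
Qed.

Lemma measurable_span_proj n : measurable_mx (span_proj n).
Proof. by apply: measurable_gsproj => i; exact: measurable_vec. Qed.

Lemma vec_unit_ae i : {ae P, forall w, bform 1%:M (v i w) (v i w) = 1}.
Proof.
have mN : measurable_fun setT (fun w => bform 1%:M (v i w) (v i w)).
  apply: measurable_bform; [exact: measurable_cst_mx| |]; exact: measurable_vec.
have sE w : (v i @^-1` @sphere R d) w <-> bform 1%:M (v i w) (v i w) = 1.
  rewrite /sphere /preimage /= norm2E; split=> [h|->]; last exact: sqrtr1.
  by rewrite -(sqr_sqrtr (bform1_ge0 (v i w))) h expr1n.
have [_ v1 _] := v_unif i.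
have mS : measurable (v i @^-1` @sphere R d).
  rewrite (_ : _ @^-1` _ = [set w | bform 1%:M (v i w) (v i w) = 1]).
    by apply: measurable_set_eq => //; exact: measurable_cst.
  by apply/funext => w; apply/propext; exact: sE.
exists (~` (v i @^-1` @sphere R d)); split; first exact: measurableC.
  by rewrite probability_setC // v1 subee.
by move=> w /= nb /sE.
Qed.

(** Only the vector of index [n] is rotated. The projector reads the vectors of smaller index and
    does not move, while [gate] commutes with the rotation. *)
Lemma gate_rot_inv n (Q : 'M[R]_d) k : (n <= m)%N -> Q *m Q^T = 1%:M ->
  let u w := gate (v (inord n) w) in
  Ex P (fun w => bform (span_proj n w) (u w *m Q) (u w *m Q) ^+ k) =
  Ex P (fun w => bform (span_proj n w) (u w) (u w) ^+ k).
Proof.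
move=> nm QQ u.
pose phi (x : tupleT) := bform (gsproj (ext_seq x) n)
  (gate (x (inord n))) (gate (x (inord n))) ^+ k.
pose Qs (i : 'I_m.+1) : 'M[R]_d := if i == inord n then Q else 1%:M.
have oQs i : Qs i *m (Qs i)^T = 1%:M.
  by rewrite /Qs; case: ifP => _ //; rewrite trmx1 mulmx1.
have mphi : measurable_fun setT phi.
  apply: measurable_funX; apply: measurable_bform.
  - exact: measurable_tuple_gsproj.
  - by apply: measurable_gate; exact: measurable_tuple_coord.
  - by apply: measurable_gate; exact: measurable_tuple_coord.
have phi0 x : 0 <= phi x.
  by rewrite exprn_ge0 // orth_proj_bform_ge0 //; exact: gsproj_orth.
have := joint_rot_inv v_unif v_ind oQs mphi phi0.
rewrite /phi => <-; congr Ex; apply/funext => w.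
have -> : Qs (inord n) = Q by rewrite /Qs eqxx.
rewrite gate_rot // /span_proj; congr (bform _ _ _ ^+ _).
apply: eq_gsproj => i i_n; rewrite /ext_seq /Qs ifF ?mulmx1 //.
apply/negbTE/eqP => /(congr1 val); rewrite /= !inordK ?ltnS //.
  by move=> e; rewrite e ltnn in i_n.
by rewrite (leq_trans (ltnW i_n)).
Qed.

(** For a unit vector, lying in the previous span means [q = 1]. The probability of [1 <= q] is at
    most every moment of [q], and the recursion makes the [k]-th moment at most [D / (D + 2k)]. *)
Lemma residual_ae n : (n <= m)%N ->
  {ae P, forall w, bform 1%:M (v (inord n) w) (v (inord n) w)
                != bform (span_proj n w) (v (inord n) w) (v (inord n) w)}.
Proof.
move=> nm; pose u w := gate (v (inord n) w).
pose q w := bform (span_proj n w) (u w) (u w).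
have mu : measurable_mx u by apply: measurable_gate; exact: measurable_vec.
have mPi := measurable_span_proj n.
have oPi w : orth_proj (span_proj n w) by exact: gsproj_orth.
have u1 w : bform 1%:M (u w) (u w) <= 1 by exact: gate_le1.
have rec := moment_recursion (mu ord0) mPi u1 oPi (fun Q k => @gate_rot_inv n Q k nm).
have bq : bm q by exact: bm_energy (mu ord0) mPi u1 oPi.
have bN := bm_sqnorm (mu ord0) u1; have bt := bm_trace mPi oPi.
have q0 w : 0 <= q w by exact: orth_proj_bform_ge0.
pose e k := Ex P (fun w => q w ^+ k).
have e0 k : 0 <= e k by apply: Ex_ge0 => w; exact: exprn_ge0.
(* The span has codimension at least 2, hence (D + 2k) E q^k is nonincreasing. *)
pose D : R := d%:R - 2.
have nD : n%:R <= D.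
  by rewrite /D lerBrDr -natrD ler_nat addn2 (leq_trans _ md) // !ltnS.
(* With [D = d - 2] the left factor [d + 2k] of the recursion is [D + 2 (k + 1)], while the trace is
   at most [n <= D]; the inequalities therefore chain. *)
have stp k : (D + 2 * k.+1%:R) * e k.+1 <= (D + 2 * k%:R) * e k.
  have -> : D + 2 * k.+1%:R = d%:R + 2 * k%:R by rewrite /D -natr1; ring.
  rewrite /e rec -ExZ; last exact: bmX.
  apply: Ex_le.
  - apply: bmM; last exact: bmX.
    by apply: bmM => //; apply: bmD => //; exact: bm_cst.
  - by apply: bmM; [exact: bm_cst | exact: bmX].
  move=> w; apply: ler_wpM2r; first exact: (exprn_ge0 k (q0 w)).
  have t1 : \tr (span_proj n w) <= n%:R by exact: gsproj_tr_le.
  have N0 := bform1_ge0 (u w); have N1 := u1 w.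
  have k0 : 0 <= k%:R :> R by [].
  apply: (@le_trans _ _ ((D + 2 * k%:R) * bform 1%:M (u w) (u w))).
    by rewrite ler_wpM2r // lerD2r (le_trans t1).
  by rewrite ler_piMr // addr_ge0 ?mulr_ge0 // (le_trans _ nD).
have bnd k : (D + 2 * k%:R) * e k <= D.
  elim: k => [|k IH]; last exact: le_trans (stp k) IH.
  by rewrite /e Ex_cst mulr0 addr0 mulr1.
pose A := [set w | 1 <= q w].
have mA : measurable A.
  by apply: measurable_set_le; [exact: measurable_cst | exact: (proj1 bq)].
pose p := Ex P \1_A.
have p0 : 0 <= p by apply: Ex_ge0 => w; rewrite indicE.
have pe k : p <= e k.
  apply: Ex_le; [exact: bm_indic | exact: bmX|move=> w].
  rewrite indicE; case: (boolP (w \in A)) => [|_]; last exact: exprn_ge0.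
  by rewrite inE => /= q1; rewrite exprn_ege1.
have D0 : 0 <= D by exact: le_trans nD.
have pz : p = 0.
  apply/eqP; rewrite eq_le p0 andbT leNgt; apply/negP => pp.
  have := bnd (Num.bound (D / p)); apply/negP; rewrite -ltNge.
  have b1 := @archi_boundP R (D / p) (divr_ge0 D0 p0).
  set k := Num.bound _ in b1 *.
  have b2 : D < k%:R * p by rewrite -ltr_pdivrMr.
  have b3 := pe k; have k0 : 0 <= k%:R :> R by [].
  have b4 : k%:R * p <= k%:R * e k by rewrite ler_wpM2l.
  have b5 : 0 <= D * e k by rewrite mulr_ge0.
  have b6 : 0 <= k%:R * e k by rewrite mulr_ge0.
  by rewrite mulrDl -mulrA; lra.
have A0 : {ae P, forall w, ~ A w}.
  exists A; split => //; first by rewrite -Ex_indic // -/p pz.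
  by move=> w /= /contrapT.
apply: filterS2 A0 (vec_unit_ae (inord n)) => w nA v1.
apply/negP => /eqP; rewrite v1 => q1; apply: nA.
by rewrite /A /= /q /u gate_unit // -q1.
Qed.

Lemma span_proj_tr_ae : {ae P, forall w, \tr (span_proj m.+1 w) = m.+1%:R}.
Proof.
suff h n : (n <= m.+1)%N -> {ae P, forall w, \tr (span_proj n w) = n%:R} by exact: h.
elim: n => [_|n IH nm]; first by apply: aeW => w; rewrite /span_proj /= mxtrace0.
apply: filterS2 (IH (ltnW nm)) (residual_ae (nm : (n <= m)%N)) => w tn rn.
by rewrite /span_proj gsproj_trS -/(span_proj n w) tn rn natr1.
Qed.

(** The boolean lets one moment computation serve both tails: the projector for the upper one, its
    complement for the lower one. *)
Definition span_or_compl (b : bool) (A : 'M[R]_d) := if b then 1%:M - A else A.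

Lemma measurable_compl (b : bool) (d1 : measure_display) (T : measurableType d1)
    (A : T -> 'M[R]_d) :
  measurable_mx A -> measurable_mx (fun t => span_or_compl b (A t)).
Proof.
move=> mA; rewrite /span_or_compl; case: b => // i j.
under [X in measurable_fun _ X]eq_fun do rewrite !mxE.
by apply: measurable_funB => //; exact: measurable_cst.
Qed.

Lemma orth_proj_compl (b : bool) (A : 'M[R]_d) :
  orth_proj A -> orth_proj (span_or_compl b A).
Proof. by rewrite /span_or_compl; case: b => // /orth_projC. Qed.

(** For a fixed [z], rotating [z] by [Q] changes the energy exactly as rotating all [v i] by [Q^T]
    does, so the joint law supplies the invariance. The trace is almost surely constant and leaves
    the expectation; halving yields the Beta parameters. *)
Lemma span_moments (b : bool) (z : 'rV[R]_d) k : bform 1%:M z z = 1 ->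
  let q w := bform (span_or_compl b (span_proj m.+1 w)) z z in
  (d%:R / 2 + k%:R) * Ex P (fun w => q w ^+ k.+1) =
  ((if b then d%:R - m.+1%:R else m.+1%:R) / 2 + k%:R) *
  Ex P (fun w => q w ^+ k).
Proof.
move=> z1 q.
pose Pi w := span_or_compl b (span_proj m.+1 w).
have mPi : measurable_mx Pi by apply: measurable_compl; exact: measurable_span_proj.
have oPi w : orth_proj (Pi w) by apply: orth_proj_compl; exact: gsproj_orth.
have z_le1 (w : Omega) : bform 1%:M z z <= 1 by rewrite z1.
have mz : measurable_mx (fun _ : Omega => z) by exact: measurable_cst_mx.
have inv (Q : 'M[R]_d) l : Q *m Q^T = 1%:M ->
    Ex P (fun w => bform (Pi w) (z *m Q) (z *m Q) ^+ l) =
    Ex P (fun w => bform (Pi w) z z ^+ l).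
  move=> QQ.
  pose phi (x : tupleT) :=
    bform (span_or_compl b (gsproj (ext_seq x) m.+1)) z z ^+ l.
  have oQ : forall i : 'I_m.+1, (fun=> Q^T) i *m ((fun=> Q^T) i)^T = 1%:M :> 'M[R]_d.
    by move=> i; rewrite trmxK; apply/mulmx1C.
  have mphi : measurable_fun setT phi.
    apply: measurable_funX; apply: measurable_bform.
    - by apply: measurable_compl; exact: measurable_tuple_gsproj.
    - exact: measurable_cst_mx.
    - exact: measurable_cst_mx.
  have phi0 x : 0 <= phi x.
    rewrite exprn_ge0 // orth_proj_bform_ge0 //.
    by apply: orth_proj_compl; exact: gsproj_orth.
  have := joint_rot_inv v_unif v_ind oQ mphi phi0; rewrite /phi => <-.
  congr Ex; apply/funext => w; congr (_ ^+ _).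
  rewrite (_ : ext_seq _ = fun i => ext_seq (fun j => v j w) i *m Q^T) //.
  rewrite gsproj_rot; last exact: (oQ ord0).
  rewrite trmxK -/(span_proj m.+1 w) /Pi /span_or_compl /bform trmx_mul !mulmxA.
  case: (b); last by rewrite !mulmxA.
  congr ((_ *m _) ord0 ord0).
  by rewrite !(mulmxBr, mulmxBl) !mulmx1 -(mulmxA z) QQ mulmx1 !mulmxA.
have bq := bm_energy (mz ord0) mPi z_le1 oPi.
have := moment_recursion (mz ord0) mPi z_le1 oPi inv k.
rewrite -/q z1; set r := (if b then _ else _).
have -> : Ex P (fun w => (\tr (Pi w) + 2 * k%:R) * 1 * q w ^+ k) =
          Ex P (fun w => (r + 2 * k%:R) * q w ^+ k).
  apply: Ex_ae.
  - apply: bmM; last exact: bmX.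
    apply: bmM; last exact: bm_cst.
    by apply: bmD; [exact: bm_trace | exact: bm_cst].
  - by apply: bmM; [exact: bm_cst | exact: bmX].
  apply: filterS span_proj_tr_ae => w tw; rewrite mulr1; congr ((_ + _) * _).
  rewrite /Pi /span_or_compl /r; case: (b); last exact: tw.
  by rewrite raddfB /= mxtrace1 tw.
rewrite ExZ; last exact: bmX.
by set x := Ex _ _; set y := Ex _ _ => h; clear z_le1; lra.
Qed.

Let energy z w := bform (span_proj m.+1 w) z z.

Lemma energy_bm z b : bform 1%:M z z = 1 ->
  bm (fun w => bform (span_or_compl b (span_proj m.+1 w)) z z) /\
  forall w, 0 <= bform (span_or_compl b (span_proj m.+1 w)) z z <= 1.
Proof.
move=> z1.
have o w : orth_proj (span_or_compl b (span_proj m.+1 w)).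
  by apply: orth_proj_compl; exact: gsproj_orth.
have bd w : 0 <= bform (span_or_compl b (span_proj m.+1 w)) z z <= 1.
  by rewrite orth_proj_bform_ge0 //= -z1; exact: orth_proj_bform_le.
split => //; split; last by exists 1 => w; have /andP[? ?] := bd w; rewrite ger0_norm.
apply: measurable_bform; [|exact: measurable_cst_mx|exact: measurable_cst_mx].
by apply: measurable_compl; exact: measurable_span_proj.
Qed.

Let d_gt0 : 0 < d%:R :> R. Proof. by rewrite ltr0n; case: d md. Qed.
Let half_d : 1 <= d%:R / 2 :> R.
Proof. by rewrite ler_pdivlMr // mul1r ler_nat (leq_trans _ md). Qed.

Lemma energy_upper_tail (z : 'rV[R]_d) (b : R) : bform 1%:M z z = 1 -> 1 <= b ->
  (P [set w | (b * m.+1%:R / d%:R < energy z w)%R]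
    <= (expR (m.+1%:R / 2 * (1 - b + ln b)))%:E)%E.
Proof.
move=> z1 b1; have b0 : 0 < b by exact: lt_le_trans b1.
have [bX X01] := energy_bm false z1; rewrite /= in bX X01.
(* A threshold of at least 1 is never exceeded by the energy of a unit vector, and the exponent
   bound needs it to be at most 1. *)
have [c1|c1] := leP 1 (b * m.+1%:R / d%:R).
  rewrite (_ : [set w | _] = set0) ?measure0 ?lee_fin ?expR_ge0 //.
  rewrite -subset0 => w /=; rewrite ltNge => /negP; apply.
  by apply: le_trans c1; have /andP[] := X01 w.
have c0 : 0 <= b * m.+1%:R / d%:R by rewrite divr_ge0 ?mulr_ge0 // ltW.
have cE : b * m.+1%:R / d%:R = b * (m.+1%:R / 2) / (d%:R / 2).
  by field; rewrite gt_eqF.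
have p0 : 0 < m.+1%:R / 2 :> R by rewrite divr_gt0.
(* The choice [s = 1 - 1/b] makes [s * b = b - 1], which produces the exponent [1 - b + ln b]. *)
have s01 : 0 <= 1 - b^-1 < 1.
  by rewrite subr_ge0 invf_le1 // b1 /= ltrBlDr ltrDl invr_gt0.
have c01 : 0 <= b * m.+1%:R / d%:R <= 1 by rewrite c0 ltW.
have tail := beta_tail bX X01 half_d (ltW p0)
  (fun k => @span_moments false z k z1) c01 s01.
apply: (@le_trans _ _ (P [set w | (b * m.+1%:R / d%:R <= energy z w)%R])).
  apply: le_measure; rewrite ?inE.
  + by apply: measurable_set_lt; [exact: measurable_cst | exact: (proj1 bX)].
  + by apply: measurable_set_le; [exact: measurable_cst | exact: (proj1 bX)].
  by move=> w /= /ltW.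
apply: le_trans tail _; rewrite lee_fin cE opprB addrCA subrr addr0.
apply: upper_exponent => //; first by rewrite divr_gt0.
by rewrite -cE ltW.
Qed.

(** A small energy is a large energy of the complementary projector, whose first Beta parameter is
    [(d - m) / 2] for a span of dimension [m]; the bound is taken at [s = 1 - b]. *)
Lemma energy_lower_tail (z : 'rV[R]_d) (b : R) : bform 1%:M z z = 1 ->
  0 < b <= 1 ->
  (P [set w | (energy z w < b * m.+1%:R / d%:R)%R]
    <= (expR (m.+1%:R / 2 * (1 - b + ln b)))%:E)%E.
Proof.
move=> z1 /andP[b0 b1].
have [bX X01] := energy_bm true z1; rewrite /= in bX X01.
have cE : b * m.+1%:R / d%:R = b * (m.+1%:R / 2) / (d%:R / 2).
  by field; rewrite gt_eqF.
set c := b * m.+1%:R / d%:R in cE *.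
have c0 : 0 <= c by rewrite divr_ge0 ?mulr_ge0 // ltW.
have mdR : m.+1%:R <= d%:R :> R by rewrite ler_nat ltnW.
have c1 : c <= 1.
  by rewrite ler_pdivrMr // mul1r (le_trans _ mdR) // ler_piMl.
have p0 : 0 <= (d%:R - m.+1%:R) / 2 :> R by rewrite divr_ge0 // subr_ge0.
have s01 : 0 <= 1 - b < 1 by rewrite subr_ge0 b1 /= ltrBlDr ltrDl.
have c01 : 0 <= 1 - c <= 1 by rewrite subr_ge0 c1 /= lerBlDr lerDl.
have tail := beta_tail bX X01 half_d p0
  (fun k => @span_moments true z k z1) c01 s01.
have eE w : bform (1%:M - span_proj m.+1 w) z z = 1 - energy z w.
  by rewrite bform_onem z1.
apply: le_trans (le_trans _ tail) _.
  apply: le_measure; rewrite ?inE.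
  + have [bY _] := energy_bm false z1.
    by apply: measurable_set_lt; [exact: (proj1 bY) | exact: measurable_cst].
  + by apply: measurable_set_le; [exact: measurable_cst | exact: (proj1 bX)].
  by move=> w /=; rewrite eE => h; lra.
rewrite lee_fin cE opprB addrCA subrr addr0.
have -> : (d%:R - m.+1%:R) / 2 = d%:R / 2 - m.+1%:R / 2 :> R by field.
apply: lower_exponent; first by rewrite b0.
by rewrite divr_gt0 //= ler_wpM2r.
Qed.

End RandomSubspace.

(** * Union bound and measurability of the minimal perturbation norm *)

(** Every index of [s] is charged, including those rejected by [Q], which spares counting the
    filtered indices. *)
Lemma probability_bigsetU_le (R : realType) (d0 : measure_display)
    (Omega : measurableType d0) (P : probability Omega R) (I : Type) (s : seq I)
    (Q : pred I) (A : I -> set Omega) (c : R) : 0 <= c ->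
  (forall i, Q i -> measurable (A i)) -> (forall i, Q i -> (P (A i) <= c%:E)%E) ->
  (P (\big[setU/set0]_(i <- s | Q i) A i) <= (c *+ size s)%:E)%E.
Proof.
move=> c0 mA PA; elim: s => [|i s IH]; first by rewrite big_nil measure0.
rewrite big_cons /= mulrS EFinD; case: ifP => Qi; last first.
  by apply: le_trans IH _; rewrite -EFinD lee_fin lerDr.
have mU : measurable (\big[setU/set0]_(j <- s | Q j) A j).
  exact: bigsetU_measurable.
by apply: le_trans (measureU2 P (mA i Qi) mU) _; rewrite leeD // PA.
Qed.

Lemma measurable_bigmine (R : realType) (d0 : measure_display)
    (T : measurableType d0) (I : Type) (s : seq I) (Q : pred I)
    (F : I -> T -> \bar R) :
  (forall i, Q i -> measurable_fun setT (F i)) ->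
  measurable_fun setT (fun t => \big[Order.min/+oo%E]_(i <- s | Q i) F i t).
Proof.
move=> mF; elim: s => [|i s IH].
  under [X in measurable_fun _ X]eq_fun do rewrite big_nil.
  exact: measurable_cst.
case Qi: (Q i); under [X in measurable_fun _ X]eq_fun do rewrite big_cons Qi.
  by apply: measurable_mine => //; exact: mF.
exact: IH.
Qed.

Lemma measurable_dist_of_energy (R : realType) (d0 : measure_display)
    (T : measurableType d0) (a : R) (q : T -> R) :
  (forall t, 0 <= q t) -> measurable_fun setT q ->
  measurable_fun setT (fun t => dist_of_energy a (q t)).
Proof.
move=> q0 mq; rewrite /dist_of_energy; apply: measurable_fun_ifT.
- by apply: measurable_fun_eqr => //; exact: measurable_cst.
- exact: measurable_cst.
- apply/measurable_EFinP; apply: measurable_funM; first exact: measurable_cst.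
  apply: measurable_ge0_inv => [t|]; first exact: sqrtr_ge0.
  exact: measurable_ge0_sqrt.
Qed.

Lemma span_rowsE (R : realType) (d m : nat) (x : 'I_m.+1 -> 'rV[R]_d) r :
  span_rows x r <-> r *m gsproj (ext_seq x) m.+1 = r.
Proof.
rewrite /span_rows /= (@gsproj_span _ _ (ext_seq x)); last first.
  by move=> i; rewrite /ext_seq inord_val; apply/rowP => j; rewrite !mxE.
by split => /eqP.
Qed.

Unset Implicit Arguments.

(** * Combination of the tail bounds with the deterministic comparison *)

Theorem theorem1 (R : realType) (d m L : nat) (delta : R)
  (W : 'M[R]_(d, L)) (b : 'rV[R]_L) (x0 : 'rV[R]_d) (khat : 'I_L)
  (d0 : measure_display) (Omega : measurableType d0)
  (P : probability Omega R) (v : 'I_m -> Omega -> 'rV[R]_d) :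
  (2 <= d)%N -> (1 <= m)%N -> (m < d)%N ->
  0 < delta < 1 ->
  (forall k : 'I_L, k != khat -> fk W b k x0 < fk W b khat x0) ->
  (forall k : 'I_L, k != khat -> col k W != col khat W) ->
  (forall i, uniform_on_sphere P (v i)) ->
  independent_vectors P v ->
  (P [set w | 
      ((Num.sqrt (zeta1 m delta) * Num.sqrt (d%:R / m%:R))%:E
         * rstar_norm W b x0 khat setT
       <= rstar_norm W b x0 khat (span_rows (fun i => v i w)))%E /\
      (rstar_norm W b x0 khat (span_rows (fun i => v i w))
       <= (Num.sqrt (zeta2 m delta) * Num.sqrt (d%:R / m%:R))%:E
          * rstar_norm W b x0 khat setT)%E]
   >= (1 - 2 * (L%:R + 1) * delta)%:E)%E.
Proof.
move=> d2 m1 md dl fkh colW v_unif v_ind.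
case: m m1 md v v_unif v_ind => // m _ md v v_unif v_ind.
have dR : 0 < d%:R :> R by rewrite ltr0n ltnW.
have mR : 0 < m.+1%:R :> R by [].
have [b1_ge1 b1_le] := zeta1V (ltn0Sn m) dl.
have [b2_01 b2_le] := zeta2V (ltn0Sn m) dl.
set b1 := (zeta1 _ _)^-1 in b1_ge1 b1_le; set b2 := (zeta2 _ _)^-1 in b2_01 b2_le.
have b1_gt0 : 0 < b1 by exact: lt_le_trans b1_ge1.
have /andP[b2_gt0 _] := b2_01.
(* These are the thresholds of the two energy tails, at the reciprocals of [zeta1] and [zeta2]. *)
pose hi := b1 * m.+1%:R / d%:R; pose lo := b2 * m.+1%:R / d%:R.
have hi0 : 0 < hi by rewrite divr_gt0 ?mulr_gt0.
have lo0 : 0 < lo by rewrite divr_gt0 ?mulr_gt0.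
have scaleE (zeta : R) : 0 < zeta^-1 ->
    Num.sqrt zeta * Num.sqrt (d%:R / m.+1%:R) =
    (Num.sqrt (zeta^-1 * m.+1%:R / d%:R))^-1.
  rewrite invr_gt0 => z0; rewrite -sqrtrM ?ltW // -sqrtrV; last first.
    by rewrite divr_ge0 ?mulr_ge0 ?invr_ge0 ?ltW.
  by congr Num.sqrt; field; rewrite !gt_eqF.
rewrite (scaleE _ b1_gt0) (scaleE _ b2_gt0) -/b1 -/b2 -/hi -/lo.
pose Pi w := span_proj v m.+1 w.
have oPi w : orth_proj (Pi w) by exact: gsproj_orth.
pose z k := direction W khat k.
have a0 k : k != khat -> 0 < margin W b x0 khat k.
  by move=> kk; rewrite subr_gt0 fkh.
have z0 k : k != khat -> z k != 0.
  move=> /colW; rewrite /z /direction -subr_eq0; apply: contra => /eqP h.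
  by rewrite -(trmxK (col k W - _)) h trmx0.
have N0 k : k != khat -> 0 < bform 1%:M (z k) (z k).
  by move=> kk; rewrite lt0r bform1_eq0 z0 ?bform1_ge0.
(* The tail bounds concern unit vectors; normalizing [z k] divides its energy by its squared
   norm. *)
pose z' k := (Num.sqrt (bform 1%:M (z k) (z k)))^-1 *: z k.
have z'E k A : k != khat ->
    bform A (z' k) (z' k) = bform A (z k) (z k) / bform 1%:M (z k) (z k).
  move=> kk; rewrite bformZl bformZr mulrA -expr2 exprVn sqr_sqrtr ?bform1_ge0 //.
  by rewrite mulrC.
have z'1 k : k != khat -> bform 1%:M (z' k) (z' k) = 1.
  by move=> kk; rewrite z'E // divff // gt_eqF // N0.
pose bad k := [set w | hi < bform (Pi w) (z' k) (z' k)]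
          `|` [set w | bform (Pi w) (z' k) (z' k) < lo].
have mq x : measurable_fun setT (fun w => bform (Pi w) x x).
  apply: measurable_bform; [exact: measurable_span_proj| |]; exact: measurable_cst_mx.
have mhi k : measurable [set w | hi < bform (Pi w) (z' k) (z' k)].
  by apply: measurable_set_lt => //; exact: measurable_cst.
have mlo k : measurable [set w | bform (Pi w) (z' k) (z' k) < lo].
  by apply: measurable_set_lt => //; exact: measurable_cst.
have mbad k : measurable (bad k) by exact: measurableU.
have Pbad k : k != khat -> (P (bad k) <= (2 * delta)%:E)%E.
  move=> kk; apply: le_trans (measureU2 P (mhi k) (mlo k)) _.
  rewrite mulr_natl mulr2n EFinD; apply: leeD.
    apply: le_trans (energy_upper_tail v_unif v_ind md (z'1 k kk) b1_ge1) _.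
    by rewrite lee_fin.
  apply: le_trans (energy_lower_tail v_unif v_ind md (z'1 k kk) b2_01) _.
  by rewrite lee_fin.
pose Bad := \big[setU/set0]_(k < L | k != khat) bad k.
have mBad : measurable Bad by apply: bigsetU_measurable.
have dl0 : 0 < delta by case/andP: dl.
(* All [L] labels are counted, [khat] included; the factor [L + 1] of the theorem leaves room for
   this. *)
have PBad : (P Bad <= (2 * delta *+ L)%:E)%E.
  have -> : L = size (index_enum 'I_L) by rewrite -[LHS]card_ord cardT enumT.
  by apply: probability_bigsetU_le => //; rewrite mulr_ge0 // ltW.
set E := [set w | _ /\ _].
(* The inclusion is pointwise: the span is the fixed space of [Pi w] at every outcome, even where
   the vectors are dependent. *)
have good : ~` Bad `<=` E.
  move=> w nB; apply: (rstar_norm_bounds (oPi w)) => // [r|k kk].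
    exact: span_rowsE.
  have nb : ~ bad k w by move=> bk; apply: nB; rewrite /Bad (bigD1 k) //=; left.
  have Nk := N0 k kk; rewrite /bad /= z'E // in nb.
  rewrite -/(z k); split.
    rewrite -ler_pdivlMr // leNgt; apply/negP => h; apply: nb; by right.
  rewrite -ler_pdivrMr // leNgt; apply/negP => h; apply: nb; by left.
(* Monotonicity of [P] requires [E] itself to be measurable, which the closed formula of [rk_normE]
   provides: the norm is a finite minimum of measurable functions of the energies. *)
have mE : measurable E.
  pose F w := rstar_norm W b x0 khat (span_rows (fun i => v i w)).
  have mF : measurable_fun setT F.
    rewrite (_ : F = fun w => \big[Order.min/+oo%E]_(k < L | k != khat)
        dist_of_energy (margin W b x0 khat k) (bform (Pi w) (z k) (z k))).
      apply: measurable_bigmine => k kk; apply: measurable_dist_of_energy => //.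
      by move=> w; exact: orth_proj_bform_ge0.
    apply/funext => w; apply: eq_bigr => k kk.
    apply: (rk_normE (oPi w)); last exact: a0.
    by move=> r; exact: span_rowsE.
  rewrite -(setTI E) -(setIid setT) /E setIACA.
  by apply: measurableI;
    [exact: emeasurable_fun_c_infty | exact: emeasurable_fun_infty_c].
apply: (@le_trans _ _ (P (~` Bad))); last first.
  by apply: le_measure; rewrite ?inE //; exact: measurableC.
rewrite probability_setC //.
apply: (@le_trans _ _ (1 - (2 * delta *+ L)%:E)%E); last by rewrite leeB.
by rewrite -EFinB lee_fin -mulr_natr; lra.
Qed.
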